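(* Let $\Bbbk$ be a PID with fraction field of characteristic zero, and let $A=A^0\oplus A^1\oplus A^2$ be a graded $\Bbbk$-algebra possessing a degree $-2$ symmetrizing form. Let $n\in\mathbb{Z}_{>0}$ and $d\in\mathbb{Z}_{\geq 0}$ with $d\leq n$. Then the subalgebra $T^A(n,d)\subseteq S^A(n,d)$ is maximally symmetric.
   Context: All $\Bbbk$-algebras are associative, unital and free of finite rank as $\Bbbk$-modules; subalgebras are unital (with the same identity). A $\Bbbk$-algebra $A$ is symmetric if it possesses a symmetrizing form, i.e. a $\Bbbk$-linear form $\mathsf t:A\to\Bbbk$ such that the bilinear form $(a,b)_{\mathsf t}:=\mathsf t(ab)$ is symmetric and $A\to\operatorname{Hom}_\Bbbk(A,\Bbbk)$, $a\mapsto(a,\cdot)_{\mathsf t}$, is an isomorphism of $\Bbbk$-modules. For $A=A^0\oplus A^1\oplus A^2$ graded ($A^iA^j\subseteq A^{i+j}$, with $A^k=0$ for $k>2$), a symmetrizing form has degree $-2$ if it vanishes on $A^0\oplus A^1$. Maximally symmetric: a full rank $\Bbbk$-subalgebra $T$ of a $\Bbbk$-algebra $S$ (i.e. $\operatorname{rank}_\Bbbk T=\operatorname{rank}_\Bbbk S$) is a maximally symmetric subalgebra if $T$ is symmetric and no $\Bbbk$-subalgebra $C$ with $T\subsetneq C\subseteq S$ is symmetric. The algebra $S^A(n,d)$: view $A$ as a superalgebra with even part $A_{\bar 0}=A^0\oplus A^2$ and odd part $A_{\bar 1}=A^1$. The matrix algebra $M_n(A)$ is a superalgebra, where for homogeneous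 $a\in A$ the matrix $\xi^a_{r,s}$ with $(r,s)$ entry $a$ and other entries $0$ has the parity of $a$. Then $M_n(A)^{\otimes d}$ is the tensor product of superalgebras, with multiplication determined by $(x\otimes y)(x'\otimes y')=(-1)^{|y||x'|}xx'\otimes yy'$ for homogeneous elements. The symmetric group $S_d$ acts on $M_n(A)^{\otimes d}$ by superalgebra automorphisms via signed place permutations: the simple transposition $(k,k+1)$ interchanges the $k$th and $(k+1)$st tensor factors $x_k,x_{k+1}$ and multiplies by $(-1)^{|x_k||x_{k+1}|}$. Put $S^A(n,d):=(M_n(A)^{\otimes d})^{S_d}$, the subalgebra of invariants. The algebra $T^A(n,d)$ (Turner's algebra, taken with $\mathfrak a=A^0$ and $\mathfrak c=A^2$): choose a $\Bbbk$-basis $B=B_{\mathfrak a}\sqcup B_{\mathfrak c}\sqcup B_{\bar 1}$ of $A$, where $B_{\mathfrak a}$, $B_{\mathfrak c}$, $B_{\bar1}$ are bases of $A^0$, $A^2$, $A^1$ respectively. Let $\operatorname{Tri}^B(n,d)$ be the set of triples $(b,r,s)$ with $b=(b_1,\dots,b_d)\in B^d$ and $r=(r_1,\dots,r_d),s=(s_1,\dots,s_d)\in\{1,\dots,n\}^d$ such that for $k\neq l$ with $(b_k,r_k,s_k)=(b_l,r_l,s_l)$ the element $b_k$ is even. For $(b,r,s)\in\operatorname{Tri}^B(n,d)$ let $\xi^{b}_{r,s}\in S^A(n,d)$ be the sum of the distinct elements of the $S_d$-orbit (under the signed action) of $\xi^{b_1}_{r_1,s_1}\otimes\cdots\otimes\xi^{b_d}_{r_d,s_d}$,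 and let $$\eta^{b}_{r,s}:=\Big(\prod_{c\in B_{\mathfrak c}}\ \prod_{1\le p,q\le n}\big(\#\{k\mid (b_k,r_k,s_k)=(c,p,q)\}\big)!\Big)\,\xi^{b}_{r,s}.$$ The elements $\xi^b_{r,s}$ (one for each orbit of $S_d$ on $\operatorname{Tri}^B(n,d)$ by simultaneous place permutations) form a $\Bbbk$-basis of $S^A(n,d)$. By definition $T^A(n,d)$ is the $\Bbbk$-span of all $\eta^b_{r,s}$ with $(b,r,s)\in\operatorname{Tri}^B(n,d)$; it is known to be a full rank unital $\Bbbk$-subalgebra of $S^A(n,d)$. *)

(* Defs.v *)
From HB Require Import structures.
From mathcomp Require Import all_boot all_order all_fingroup all_algebra.
From mathcomp Require Import classical_sets ring zify.

Set Implicit Arguments.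
Unset Strict Implicit.
Unset Printing Implicit Defensive.

Import GRing.Theory.
Local Open Scope ring_scope.
Local Open Scope classical_set_scope.

Definition is_ideal (R : nzRingType) (I : set R) : Prop :=
  [/\ I 0, forall x y, I x -> I y -> I (x + y) & forall a x, I x -> I (a * x)].

Definition is_pid (R : idomainType) : Prop :=
  forall I : set R, is_ideal I -> exists g, I = [set a * g | a in [set: R]].

(* Unlike the library's [algType], this allows the zero algebra. *)
Record kalgebra (k : nzRingType) := KAlgebra {
  ka_mod : lmodType k;
  ka_one : ka_mod;
  ka_mul : ka_mod -> ka_mod -> ka_mod;
  ka_mulA : associative ka_mul;
  ka_mul1l : left_id ka_one ka_mul;
  ka_mul1r : right_id ka_one ka_mul;
  ka_mulDl : left_distributive ka_mul +%R;
  ka_mulDr : right_distributive ka_mul +%R;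
  ka_scaleAl : forall a x y, a *: ka_mul x y = ka_mul (a *: x) y;
  ka_scaleAr : forall a x y, a *: ka_mul x y = ka_mul x (a *: y)
}.

Definition ka_sort (k : nzRingType) (A : kalgebra k) : Type := ka_mod A.
Coercion ka_sort : kalgebra >-> Sortclass.
Arguments ka_sort : simpl never.

HB.instance Definition _ (k : nzRingType) (A : kalgebra k) :=
  GRing.Lmodule.copy (ka_sort A) (ka_mod A).
HB.instance Definition _ (k : nzRingType) (A : kalgebra k) :=
  GRing.Zmodule_isPzRing.Build (ka_sort A)
    (@ka_mulA k A) (@ka_mul1l k A) (@ka_mul1r k A) (@ka_mulDl k A)
    (@ka_mulDr k A).

Lemma kalg_scaleAl (k : nzRingType) (A : kalgebra k) a (x y : A) :
  a *: (x * y) = (a *: x) * y.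
Proof. exact: ka_scaleAl. Qed.

Lemma kalg_scaleAr (k : nzRingType) (A : kalgebra k) a (x y : A) :
  a *: (x * y) = x * (a *: y).
Proof. exact: ka_scaleAr. Qed.

Section Modules.
Variables (k : idomainType) (V : lmodType k).
Implicit Types (U : set V) (f : V -> k).

Definition is_submodule U : Prop :=
  U 0 /\ forall a x y, U x -> U y -> U (a *: x + y).

(* The family [v i], for [i] satisfying [P], is a basis of [U]. *)
Definition is_basis (I : finType) (P : pred I) (v : I -> V) U : Prop :=
  U = [set \sum_(i | P i) c i *: v i | c in [set: I -> k]] /\
  forall c : I -> k, \sum_(i | P i) c i *: v i = 0 -> forall i, P i -> c i = 0.

Definition has_rank U (m : nat) : Prop :=
  exists v : 'I_m -> V, is_basis predT v U.

(* Linear forms on [U] are represented by functions on [V] whose values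
   outside [U] are irrelevant: over a PID a form need not extend to [V]. *)
Definition linear_on U f : Prop :=
  forall a x y, U x -> U y -> f (a *: x + y) = a * f x + f y.

End Modules.

Section Subalgebras.
Variables (k : idomainType) (E : kalgebra k).
Implicit Types (C S T : set E) (t : E -> k).

Definition is_subalgebra C : Prop :=
  [/\ is_submodule C, C 1, forall x y, C x -> C y -> C (x * y)
    & exists m, has_rank C m].

(* The last clause: [x |-> t (x * _)] is a bijection from [C] onto the linear
   forms on [C]. *)
Definition symmetrizing_form C t : Prop :=
  [/\ linear_on C t,
      forall x y, C x -> C y -> t (x * y) = t (y * x)
    & forall f : E -> k, linear_on C f ->
        exists! x, C x /\ forall y, C y -> t (x * y) = f y].

Definition is_symmetric C : Prop := exists t, symmetrizing_form C t.

Definition full_rank S T : Prop := exists m, has_rank T m /\ has_rank S m.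

Definition maximally_symmetric S T : Prop :=
  [/\ is_subalgebra S,
      [/\ is_subalgebra T, T `<=` S & full_rank S T],
      is_symmetric T
    & forall C, is_subalgebra C -> T `<` C -> C `<=` S -> ~ is_symmetric C].

End Subalgebras.

Record graded_algebra (k : idomainType) := GradedAlgebra {
  ga_alg :> kalgebra k;
  ga_comp : nat -> set ga_alg;
  ga_submodule : forall i, is_submodule (ga_comp i);
  ga_comp_gt2 : forall i, (2 < i)%N -> ga_comp i = [set 0];
  ga_direct : forall a : ga_alg, exists! q : ga_alg * ga_alg * ga_alg,
    [/\ ga_comp 0 q.1.1, ga_comp 1 q.1.2, ga_comp 2 q.2
      & a = q.1.1 + q.1.2 + q.2];
  ga_mul : forall i j a b, ga_comp i a -> ga_comp j b -> ga_comp (i + j) (a * b)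
}.
Arguments ga_comp {k} g i.

Definition degree_m2 (k : idomainType) (A : graded_algebra k) (t : A -> k) :=
  forall a0 a1 : A, ga_comp A 0 a0 -> ga_comp A 1 a1 -> t (a0 + a1) = 0.

(* A disjoint union of bases of the components of degree 0, 1 and 2: these are
   B_a, B_1 and B_c respectively. *)
Record homog_basis (k : idomainType) (A : graded_algebra k) := HomogBasis {
  hb_idx :> finType;
  hb_vec : hb_idx -> A;
  hb_deg : hb_idx -> 'I_3;
  hb_basis : forall i : 'I_3,
    is_basis [pred b | hb_deg b == i] hb_vec (ga_comp A i)
}.

(* d-th tensor power of a superalgebra with basis [I], parity [p], structure
   constants [c], and identity of coordinates [e]. *)
Section TwistedPower.
Variables (k : idomainType) (I : finType) (d : nat).
Variables (p : I -> bool) (c : I -> I -> I -> k) (e : I -> k).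

Local Notation mi := {ffun 'I_d -> I}.
Local Notation E := {ffun mi -> k^o}.

(* The sign of moving each factor [y j] leftwards past the [x i], [j < i]. *)
Definition tw_sign (x y : mi) : k :=
  \prod_(i < d) \prod_(j < d | (j < i)%N) (-1) ^+ (p (x i) && p (y j)).

Definition tw_mul (u v : E) : E :=
  \sum_x \sum_y (u x * v y * tw_sign x y) *:
    ([ffun z : mi => \prod_(i < d) c (x i) (y i) (z i)] : E).

Definition tw_one : E := [ffun z : mi => \prod_(i < d) e (z i)].

Hypothesis cA : forall i j l o,
  \sum_m c i j m * c m l o = \sum_m c j l m * c i m o.
Hypothesis cp : forall i j m, c i j m != 0 -> p m = p i (+) p j.
Hypothesis ce1 : forall j o, \sum_i e i * c i j o = (j == o)%:R.
Hypothesis c1e : forall j o, \sum_i e i * c j i o = (j == o)%:R.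
Hypothesis ep : forall i, e i != 0 -> p i = false.

Let C (x y z : mi) : k := \prod_(i < d) c (x i) (y i) (z i).

Lemma tw_mulE u v z :
  tw_mul u v z = \sum_x \sum_y u x * v y * tw_sign x y * C x y z.
Proof.
rewrite sum_ffunE; apply: eq_bigr => x _; rewrite sum_ffunE.
by apply: eq_bigr => y _; rewrite !ffunE.
Qed.

Let C_sign_l x y m z :
  C x y m * tw_sign m z = C x y m * (tw_sign x z * tw_sign y z).
Proof.
have [->|nz] := eqVneq (C x y m) 0; first by rewrite !mul0r.
have {}nz i : p (m i) = p (x i) (+) p (y i).
  by apply: cp; move/prodf_neq0: nz; apply.
congr (_ * _); rewrite /tw_sign -big_split /=; apply: eq_bigr => i _.
rewrite -big_split /=; apply: eq_bigr => j _; rewrite nz.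
by case: (p (x i)) (p (y i)) (p (z j)) => [] [] [];
  rewrite ?mulrNN ?mulr1 ?mul1r.
Qed.

Let C_sign_r x y m z :
  C x y m * tw_sign z m = C x y m * (tw_sign z x * tw_sign z y).
Proof.
have [->|nz] := eqVneq (C x y m) 0; first by rewrite !mul0r.
have {}nz i : p (m i) = p (x i) (+) p (y i).
  by apply: cp; move/prodf_neq0: nz; apply.
congr (_ * _); rewrite /tw_sign -big_split /=; apply: eq_bigr => i _.
rewrite -big_split /=; apply: eq_bigr => j _; rewrite nz.
by case: (p (x j)) (p (y j)) (p (z i)) => [] [] [];
  rewrite ?mulrNN ?mulr1 ?mul1r.
Qed.

Let C_assoc x y z t : \sum_m C x y m * C m z t = \sum_m C y z m * C x m t.
Proof.
under eq_bigr => m _ do rewrite -big_split /=.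
under [RHS]eq_bigr => m _ do rewrite -big_split /=.
rewrite -(bigA_distr_bigA (fun i o => c (x i) (y i) o * c o (z i) (t i))).
rewrite -(bigA_distr_bigA (fun i o => c (y i) (z i) o * c (x i) o (t i))).
by apply: eq_bigr => i _; apply: cA.
Qed.

Lemma tw_mulA : associative tw_mul.
Proof.
move=> u v w; apply/ffunP => t; rewrite !tw_mulE.
pose F x y z := u x * v y * w z *
  (tw_sign x y * tw_sign x z * tw_sign y z) * \sum_m C x y m * C m z t.
transitivity (\sum_x \sum_y \sum_z F x y z).
  apply: eq_bigr => x _.
  transitivity (\sum_m \sum_y \sum_z u x * v y * w z * tw_sign y z *
      (C y z m * tw_sign x m) * C x m t).
    apply: eq_bigr => m _; rewrite tw_mulE mulr_sumr !mulr_suml.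
    apply: eq_bigr => y _; rewrite mulr_sumr !mulr_suml.
    by apply: eq_bigr => z _; ring.
  rewrite exchange_big; apply: eq_bigr => y _ /=.
  rewrite exchange_big; apply: eq_bigr => z _ /=.
  rewrite /F C_assoc mulr_sumr; apply: eq_bigr => m _.
  by rewrite C_sign_r; ring.
transitivity (\sum_m \sum_x \sum_y \sum_z u x * v y * w z * tw_sign x y *
    (C x y m * tw_sign m z) * C m z t).
  symmetry; rewrite exchange_big; apply: eq_bigr => x _ /=.
  rewrite exchange_big; apply: eq_bigr => y _ /=.
  rewrite exchange_big; apply: eq_bigr => z _ /=.
  rewrite /F mulr_sumr; apply: eq_bigr => m _.
  by rewrite C_sign_l; ring.
apply: eq_bigr => m _.
under eq_bigr => x _ do rewrite exchange_big /=.
rewrite exchange_big; apply: eq_bigr => z _ /=.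
rewrite tw_mulE !mulr_suml; apply: eq_bigr => x _.
by rewrite !mulr_suml; apply: eq_bigr => y _; ring.
Qed.

Let e_sign m y : tw_one m * tw_sign m y = tw_one m
  /\ tw_one m * tw_sign y m = tw_one m.
Proof.
have [->|] := eqVneq (tw_one m) 0; first by rewrite !mul0r.
rewrite ffunE => /prodf_neq0 nz.
have {}nz i : p (m i) = false by apply: ep; apply: nz.
by split; rewrite -[RHS]mulr1; congr (_ * _); apply: big1 => i _;
  apply: big1 => j _; rewrite nz ?andbF.
Qed.

Let delta_prod (v : E) (t : mi) :
  \sum_y v y * \prod_(i < d) (y i == t i)%:R = v t.
Proof.
rewrite (bigD1 t) //= [X in _ * X]big1 ?mulr1 => [|i _]; last by rewrite eqxx.
rewrite big1 ?addr0 // => y ne; have [i ney] : exists i, y i != t i.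
  by apply/existsP; apply: contraR ne => /existsPn h; apply/eqP/ffunP => i;
    apply/eqP; move: (h i); rewrite negbK.
by rewrite (bigD1 i) //= (negbTE ney) mul0r mulr0.
Qed.

Lemma tw_mul1l : left_id tw_one tw_mul.
Proof.
move=> v; apply/ffunP => t; rewrite tw_mulE exchange_big /= -[RHS]delta_prod.
apply: eq_bigr => y _.
transitivity (\sum_(m : mi) v y * \prod_i (e (m i) * c (m i) (y i) (t i))).
  apply: eq_bigr => m _; rewrite big_split /= -/(C m y t).
  have := proj1 (e_sign m y); rewrite ffunE => h.
  by rewrite (mulrC _ (v y)) -(mulrA (v y)) h mulrA.
rewrite -mulr_sumr -(bigA_distr_bigA (fun i o => e o * c o (y i) (t i))).
by congr (_ * _); apply: eq_bigr => i _; rewrite ce1.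
Qed.

Lemma tw_mul1r : right_id tw_one tw_mul.
Proof.
move=> v; apply/ffunP => t; rewrite tw_mulE -[RHS]delta_prod.
apply: eq_bigr => y _.
transitivity (\sum_(m : mi) v y * \prod_i (e (m i) * c (y i) (m i) (t i))).
  apply: eq_bigr => m _; rewrite big_split /= -/(C y m t).
  have := proj2 (e_sign m y); rewrite ffunE => h.
  by rewrite -(mulrA (v y)) h mulrA.
rewrite -mulr_sumr -(bigA_distr_bigA (fun i o => e o * c (y i) o (t i))).
by congr (_ * _); apply: eq_bigr => i _; rewrite c1e.
Qed.

Lemma tw_mulDl : left_distributive tw_mul +%R.
Proof.
move=> u v w; apply/ffunP => t; rewrite [RHS]ffunE !tw_mulE -big_split /=.
apply: eq_bigr => x _; rewrite -big_split /=.
by apply: eq_bigr => y _; rewrite ffunE; ring.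
Qed.

Lemma tw_mulDr : right_distributive tw_mul +%R.
Proof.
move=> u v w; apply/ffunP => t; rewrite [RHS]ffunE !tw_mulE -big_split /=.
apply: eq_bigr => x _; rewrite -big_split /=.
by apply: eq_bigr => y _; rewrite ffunE; ring.
Qed.

Lemma tw_scaleAl a u v : a *: tw_mul u v = tw_mul (a *: u) v.
Proof.
rewrite scaler_sumr; apply: eq_bigr => x _; rewrite scaler_sumr.
by apply: eq_bigr => y _; rewrite scalerA ffunE !mulrA.
Qed.

Lemma tw_scaleAr a u v : a *: tw_mul u v = tw_mul u (a *: v).
Proof.
rewrite scaler_sumr; apply: eq_bigr => x _; rewrite scaler_sumr.
apply: eq_bigr => y _; rewrite scalerA ffunE; congr (_ *: _).
rewrite /GRing.scale /=; ring.
Qed.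

Definition tw_algebra : kalgebra k :=
  KAlgebra tw_mulA tw_mul1l tw_mul1r tw_mulDl tw_mulDr tw_scaleAl tw_scaleAr.

End TwistedPower.

Section HomogBasis.
Variables (k : idomainType) (A : graded_algebra k) (B : homog_basis A).

Let o0 : 'I_3 := inord 0.
Let o1 : 'I_3 := inord 1.
Let o2 : 'I_3 := inord 2.

Let ord3E (i : 'I_3) : [\/ i = o0, i = o1 | i = o2].
Proof.
case: i => [[|[|[|i]]] lti] //; [constructor 1|constructor 2|constructor 3];
  by apply/val_inj; rewrite /= inordK.
Qed.

Let sum_deg (c : B -> k) : \sum_b c b *: hb_vec b =
  \sum_(b | hb_deg b == o0) c b *: hb_vec b
  + \sum_(b | hb_deg b == o1) c b *: hb_vec b
  + \sum_(b | hb_deg b == o2) c b *: hb_vec b.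
Proof.
rewrite (partition_big (@hb_deg _ _ B) xpredT) //=.
by rewrite !big_ord_recl big_ord0 addr0 addrA; congr (_ + _ + _);
  apply: eq_bigl => b; congr (_ == _); apply/val_inj; rewrite /= inordK.
Qed.

Let comp_sum (i : 'I_3) (c : B -> k) :
  ga_comp A i (\sum_(b | hb_deg b == i) c b *: hb_vec b).
Proof. by rewrite (proj1 (hb_basis B i)); exists c. Qed.

Lemma hb_spanning (a : A) :
  exists c : {ffun B -> k}, a == \sum_b c b *: hb_vec b.
Proof.
have [[[a0 a1] a2] [[/= h0 h1 h2 ->] _]] := ga_direct a.
have e0 : ga_comp A o0 a0 by rewrite inordK.
have e1 : ga_comp A o1 a1 by rewrite inordK.
have e2 : ga_comp A o2 a2 by rewrite inordK.
move: e0 e1 e2; rewrite !(proj1 (hb_basis B _)).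
move=> [c0 _ <-] [c1 _ <-] [c2 _ <-].
exists [ffun b => if hb_deg b == o0 then c0 b
                  else if hb_deg b == o1 then c1 b else c2 b].
apply/eqP; rewrite sum_deg.
by congr (_ + _ + _); apply: eq_bigr => b /eqP h; rewrite ffunE h;
  rewrite -!val_eqE /= !inordK.
Qed.

(* The coordinate of [a] on [b] in the basis [B]. *)
Definition hb_coord (b : B) (a : A) : k^o := xchoose (hb_spanning a) b.

Lemma hb_coordK a : \sum_b hb_coord b a *: hb_vec b = a.
Proof. by rewrite [RHS](eqP (xchooseP (hb_spanning a))). Qed.

Lemma hb_free (c : B -> k) : \sum_b c b *: hb_vec b = 0 -> forall b, c b = 0.
Proof.
rewrite sum_deg => h b.
have z i : ga_comp A i 0 := proj1 (ga_submodule A i).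
have [q [_ q_uniq]] := ga_direct (0 : A).
have h0 := comp_sum o0 c; rewrite {1}inordK // in h0.
have h1 := comp_sum o1 c; rewrite {1}inordK // in h1.
have h2 := comp_sum o2 c; rewrite {1}inordK // in h2.
have E1 := q_uniq (_, _, _) (And4 h0 h1 h2 (esym h)).
have E0 := q_uniq (0, 0, 0).
have {}E0 : q = (0, 0, 0) by apply: E0; split; rewrite //= !addr0.
rewrite {}E0 in E1; case: E1 => /esym {}h0 /esym {}h1 /esym {}h2.
have [i|i|i] := ord3E (hb_deg b).
- by apply: (proj2 (hb_basis B o0) c h0); rewrite /= i.
- by apply: (proj2 (hb_basis B o1) c h1); rewrite /= i.
- by apply: (proj2 (hb_basis B o2) c h2); rewrite /= i.
Qed.

Lemma hb_coordE (c : B -> k) b : hb_coord b (\sum_b c b *: hb_vec b) = c b.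
Proof.
apply/eqP; rewrite -subr_eq0; apply/eqP; move: b.
apply: (hb_free (c := fun b => _ - c b)).
under eq_bigr => b _ do rewrite scalerBl.
by rewrite sumrB hb_coordK subrr.
Qed.

Lemma hb_coord_linear b : linear (hb_coord b).
Proof.
move=> x a a'; rewrite -{1}(hb_coordK a) -{1}(hb_coordK a').
rewrite scaler_sumr -big_split /=.
under eq_bigr => b' _ do rewrite scalerA -scalerDl.
by rewrite (hb_coordE (fun b => _ * _ + _)).
Qed.

HB.instance Definition _ b :=
  GRing.isLinear.Build k A k^o *:%R (hb_coord b)
    (hb_coord_linear b).

Lemma hb_coord_vec b b' : hb_coord b' (hb_vec b) = (b == b')%:R.
Proof.
have -> : hb_vec b = \sum_b0 (b == b0)%:R *: hb_vec b0.
  rewrite (bigD1 b) //= eqxx scale1r big1 ?addr0 // => b0.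
  by rewrite eq_sym => /negbTE ->; rewrite scale0r.
by rewrite (hb_coordE (fun b0 => (b == b0)%:R)).
Qed.

Lemma hb_coord_deg i a b :
  ga_comp A i a -> hb_coord b a != 0 -> hb_deg b = i :> nat.
Proof.
have [lti|gti] := ltnP i 3; last first.
  rewrite (ga_comp_gt2 A gti) => ->.
  by rewrite linear0 eqxx.
rewrite -[i]/(nat_of_ord (Ordinal lti)) (proj1 (hb_basis B _)) => -[c _ <-].
rewrite big_mkcond /=.
under eq_bigr => b' _.
  rewrite (_ : (if _ then _ else _) =
    (if hb_deg b' == Ordinal lti then c b' else 0) *: hb_vec b'); last first.
    by case: ifP; rewrite ?scale0r.
  over.
rewrite hb_coordE.
by case: (hb_deg b =P _) => [->|]; rewrite ?eqxx.
Qed.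

Lemma hb_vec_comp (b : B) : ga_comp A (hb_deg b) (hb_vec b).
Proof.
rewrite (proj1 (hb_basis B _)); exists (fun b' => (b' == b)%:R) => //.
rewrite (bigD1 b) //= eqxx scale1r big1 ?addr0 // => b' /andP[_ /negbTE ->].
by rewrite scale0r.
Qed.

Lemma ga_comp1 : ga_comp A 0 1.
Proof.
have [[[e0 e1] e2] [[/= h0 h1 h2 e] _]] := ga_direct (1 : A).
suff idr (a : A) : a * e0 = a by rewrite -[1](idr 1) mul1r.
rewrite -(hb_coordK a) mulr_suml; apply: eq_bigr => b _.
rewrite -kalg_scaleAl; congr (_ *: _).
set v : A := hb_vec b; have hv : ga_comp A (hb_deg b) v := hb_vec_comp b.
have hv0 : ga_comp A (hb_deg b) (v * e0).
  by rewrite -[nat_of_ord _]addn0; apply: ga_mul.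
have ev : v = v * e0 + v * e1 + v * e2 by rewrite -!mulrDr -e mulr1.
rewrite -(hb_coordK (v * e0)) -[RHS]hb_coordK; apply: eq_bigr => b' _.
congr (_ *: _).
pose f := hb_coord b'.
have fD : {morph f : x y / x + y} by move=> x y; rewrite /f linearD.
have fev : f v = f (v * e0) + f (v * e1) + f (v * e2) by rewrite {1}ev !fD.
have [db|db] := eqVneq (hb_deg b' : nat) (hb_deg b); last first.
  transitivity (0 : k).
    by apply: contraNeq db => /(hb_coord_deg hv0) ->.
  by symmetry; apply: contraNeq db => /(hb_coord_deg hv) ->.
suff [z1 z2] : f (v * e1) = 0 /\ f (v * e2) = 0.
  by rewrite -/(f (v * e0)) -/(f v) fev z1 z2 !addr0.
split; apply/eqP; apply: contraT => nz.
  have := hb_coord_deg (ga_mul hv h1) nz; rewrite db => /eqP.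
  by rewrite -[X in X == _]addn0 eqn_add2l.
have := hb_coord_deg (ga_mul hv h2) nz; rewrite db => /eqP.
by rewrite -[X in X == _]addn0 eqn_add2l.
Qed.

End HomogBasis.

Section TurnerAlgebra.
Variables (k : idomainType) (A : graded_algebra k) (B : homog_basis A).
Variables (n d : nat).

(* (b, r, s) indexes the element xi^b_{r,s} of the matrix algebra. *)
Definition mx_idx : finType := (B * 'I_n * 'I_n)%type.
Implicit Types (M N : 'M[A]_n).

Definition mx_elt (a : A) (r s : 'I_n) : 'M[A]_n :=
  \matrix_(r', s') (if (r' == r) && (s' == s) then a else 0).

Definition mx_vec (i : mx_idx) : 'M[A]_n := mx_elt (hb_vec i.1.1) i.1.2 i.2.

Definition mx_coord (i : mx_idx) M : k := hb_coord i.1.1 (M i.1.2 i.2).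

Definition mx_odd (i : mx_idx) : bool := odd (hb_deg i.1.1).

Definition mx_mul_coef (i j l : mx_idx) : k := mx_coord l (mx_vec i *m mx_vec j).

Definition mx_one_coef (i : mx_idx) : k := mx_coord i 1%:M.

Let scal (x : k) M : 'M[A]_n := map_mx ( *:%R x) M.

Let scal_mull x M N : scal x (M *m N) = scal x M *m N.
Proof.
apply/matrixP => r s; rewrite !mxE scaler_sumr.
by apply: eq_bigr => t _; rewrite mxE kalg_scaleAl.
Qed.

Let scal_mulr x M N : scal x (M *m N) = M *m scal x N.
Proof.
apply/matrixP => r s; rewrite !mxE scaler_sumr.
by apply: eq_bigr => t _; rewrite mxE kalg_scaleAr.
Qed.

Let mx_coord_scal x M i : mx_coord i (scal x M) = x * mx_coord i M.
Proof. by rewrite /mx_coord mxE linearZ. Qed.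

Let mx_coord_sum (J : finType) (F : J -> 'M[A]_n) i :
  mx_coord i (\sum_j F j) = \sum_j mx_coord i (F j).
Proof. by rewrite /mx_coord summxE linear_sum. Qed.

Let mx_expand M : M = \sum_i scal (mx_coord i M) (mx_vec i).
Proof.
apply/matrixP => r s; rewrite summxE -[LHS](hb_coordK B).
rewrite (eq_bigr (fun i => if (i.1.2 == r) && (i.2 == s)
    then hb_coord i.1.1 (M r s) *: (hb_vec i.1.1 : A) else 0)); last first.
  move=> [[b r'] s'] _; rewrite !mxE /= [r' == _]eq_sym [s' == _]eq_sym.
  by case: eqP => [->|_]; case: eqP => [->|_]; rewrite ?scaler0.
rewrite -big_mkcond (reindex_onto (fun b : B => (b, r, s)) (fun i => i.1.1)).
  by apply: eq_bigl => b; rewrite /= !eqxx.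
by move=> [[b r'] s'] /= /andP[/eqP -> /eqP ->].
Qed.

Let mx_mulA i j l o : \sum_m mx_mul_coef i j m * mx_mul_coef m l o
  = \sum_m mx_mul_coef j l m * mx_mul_coef i m o.
Proof.
transitivity (mx_coord o (mx_vec i *m mx_vec j *m mx_vec l)).
  rewrite [mx_vec i *m _]mx_expand mulmx_suml mx_coord_sum.
  by apply: eq_bigr => m _; rewrite -scal_mull mx_coord_scal.
rewrite -mulmxA [mx_vec j *m _]mx_expand mulmx_sumr mx_coord_sum.
by apply: eq_bigr => m _; rewrite -scal_mulr mx_coord_scal.
Qed.

Let mx_coord_vec i j : mx_coord j (mx_vec i) = (i == j)%:R.
Proof.
case: i j => [[b r] s] [[b' r'] s']; rewrite /mx_coord mxE /=.
rewrite !xpair_eqE [r' == _]eq_sym [s' == _]eq_sym.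
by case: ifP => [/andP[-> ->]|]; rewrite ?andbT ?hb_coord_vec // -andbA => ->;
  rewrite andbF linear0.
Qed.

Let mx_mul1l j o : \sum_i mx_one_coef i * mx_mul_coef i j o = (j == o)%:R.
Proof.
rewrite -mx_coord_vec -[in RHS](mul1mx (mx_vec j)) [in RHS](mx_expand 1%:M).
rewrite mulmx_suml mx_coord_sum.
by apply: eq_bigr => m _; rewrite -scal_mull mx_coord_scal.
Qed.

Let mx_mul1r j o : \sum_i mx_one_coef i * mx_mul_coef j i o = (j == o)%:R.
Proof.
rewrite -mx_coord_vec -[in RHS](mulmx1 (mx_vec j)) [in RHS](mx_expand 1%:M).
rewrite mulmx_sumr mx_coord_sum.
by apply: eq_bigr => m _; rewrite -scal_mulr mx_coord_scal.
Qed.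

Let mx_mul_odd i j m :
  mx_mul_coef i j m != 0 -> mx_odd m = mx_odd i (+) mx_odd j.
Proof.
move=> nz; rewrite /mx_odd -oddD; congr odd.
apply: (hb_coord_deg _ nz); rewrite mxE.
have [z addc] := ga_submodule A (hb_deg i.1.1 + hb_deg j.1.1).
apply: (big_ind (ga_comp A (hb_deg i.1.1 + hb_deg j.1.1))) => //.
  by move=> x y hx hy; rewrite -[x]scale1r; apply: addc.
move=> t _; rewrite !mxE; case: ifP => _; last by rewrite mul0r.
case: ifP => _; last by rewrite mulr0.
by apply: ga_mul; apply: hb_vec_comp.
Qed.

Let mx_one_odd i : mx_one_coef i != 0 -> mx_odd i = false.
Proof.
move=> nz; rewrite /mx_odd (hb_coord_deg (i := 0) _ nz) //.
rewrite mxE; case: eqP => _; first exact: (ga_comp1 B).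
exact: (proj1 (ga_submodule A 0)).
Qed.

(* The d-th tensor power of the superalgebra of n x n matrices over [A]. It is
   free on the tensors of matrices xi^b_{r,s}, indexed by [x : {ffun 'I_d ->
   mx_idx}]; an element is represented by its coordinates in this basis. *)
Definition tens : kalgebra k :=
  tw_algebra d mx_mulA mx_mul_odd mx_mul1l mx_mul1r mx_one_odd.

Local Notation mi := {ffun 'I_d -> mx_idx}.

Definition pure_tens (X : 'I_d -> 'M[A]_n) : tens :=
  [ffun z : mi => \prod_(i < d) mx_coord (z i) (X i)].

Definition tens_coord (u : tens) (x : mi) : k := (u : {ffun mi -> k^o}) x.

Definition tens_vec (x : mi) : tens := pure_tens (fun i : 'I_d => mx_vec (x i)).

(* The place permutation moves the factor in place [w i] to place [i]; its
   sign counts the pairs of odd factors which are interchanged. *)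
Definition perm_sign (w : 'S_d) (x : mi) : k :=
  \prod_(i < d) \prod_(j < d | (i < j)%N && (w j < w i)%N)
    (-1) ^+ (mx_odd (x (w i)) && mx_odd (x (w j))).

Definition perm_act (w : 'S_d) (u : tens) : tens :=
  \sum_(x : mi) (tens_coord u x * perm_sign w x) *:
    tens_vec [ffun i : 'I_d => x (w i)].

Lemma tens_coord_vec x y : tens_coord (tens_vec x) y = (x == y)%:R.
Proof.
rewrite /tens_coord ffunE; have [->|ne] := eqVneq x y.
  by apply: big1 => i _; rewrite mx_coord_vec eqxx.
have [i nei] : exists i, x i != y i.
  apply/existsP; apply: contraR ne => /existsPn h; apply/eqP/ffunP => i.
  by apply/eqP; move: (h i); rewrite negbK.
by rewrite (bigD1 i) //= mx_coord_vec (negbTE nei) mul0r.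
Qed.

Lemma tens_mul_vec (x y : mi) :
  tens_vec x * tens_vec y =
    tw_sign k mx_odd x y *: pure_tens (fun i => mx_vec (x i) *m mx_vec (y i)).
Proof.
have V x' y' : (tens_vec x' : {ffun mi -> k^o}) y' = (x' == y')%:R.
  exact: tens_coord_vec.
apply/ffunP => z; rewrite [LHS]tw_mulE (bigD1 x) //= [X in _ + X]big1 => [|x' ne].
  rewrite addr0 (bigD1 y) //= [X in _ + X]big1 => [|y' ne].
    by rewrite addr0 !V !eqxx !mul1r !ffunE.
  by rewrite [X in _ * X * _ * _]V eq_sym (negbTE ne) mulr0 !mul0r.
by apply: big1 => y' _; rewrite V eq_sym (negbTE ne) !mul0r.
Qed.

Lemma perm_act_vec (w : 'S_d) (x : mi) :
  perm_act w (tens_vec x) =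
    perm_sign w x *: tens_vec [ffun i : 'I_d => x (w i)].
Proof.
rewrite /perm_act (bigD1 x) //= tens_coord_vec eqxx mul1r big1 ?addr0 // => y.
by rewrite eq_sym tens_coord_vec => /negbTE ->; rewrite mul0r scale0r.
Qed.

Lemma perm_sign_tperm (i j : 'I_d) (x : mi) : j = i.+1 :> nat ->
  perm_sign (tperm i j) x = (-1) ^+ (mx_odd (x i) && mx_odd (x j)).
Proof.
move=> ij.
have tE (l : 'I_d) : tperm i j l =
    (if l == i :> nat then j else if l == j :> nat then i else l) :> nat.
  by rewrite permE /= -!val_eqE /=; do ?case: ifP.
rewrite /perm_sign (bigD1 i) //= [X in _ * X]big1 ?mulr1 => [|l].
  rewrite (bigD1 j) /=; last by rewrite tpermL tpermR ij ltnSn.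
  rewrite tpermL tpermR andbC big1 ?mulr1 // => l; rewrite -val_eqE tE /=.
  by do ?case: ifP; lia.
rewrite -val_eqE /= => li; apply: big1 => m; rewrite !tE.
by do ?case: ifP; lia.
Qed.

Definition S_alg : set tens := [set u | forall w : 'S_d, perm_act w u = u].

Definition Tri (x : mi) : bool :=
  [forall i : 'I_d, forall j : 'I_d,
    (i != j) && (x i == x j) ==> ~~ mx_odd (x i)].

Definition xi (x : mi) : tens :=
  \sum_(u <- undup [seq perm_act w (tens_vec x) | w : 'S_d]) u.

Definition eta_coef (x : mi) : nat :=
  (\prod_(c : B | hb_deg c == 2 :> nat) \prod_(p < n) \prod_(q < n)
    (#|[pred i : 'I_d | x i == (c, p, q)]|)`!)%N.

Definition eta (x : mi) : tens := (eta_coef x)%:R *: xi x.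

Definition T_alg : set tens :=
  [set \sum_(x : mi | Tri x) a x *: eta x | a in [set: mi -> k]].

End TurnerAlgebra.

Arguments tens {k A} B n d.
Arguments S_alg {k A} B n d.
Arguments T_alg {k A} B n d.

(* Main.v *)
From HB Require Import structures.
Require Import Defs.
From mathcomp Require Import classical_sets ring.
From mathcomp Require Import all_boot all_fingroup all_algebra.

Set Implicit Arguments.
Unset Strict Implicit.
Unset Printing Implicit Defensive.

Import GroupScope GRing.Theory.
Local Open Scope ring_scope.

(** Let [E] be the [d]-th tensor power of the matrix algebra, [S] its algebra
    of invariants, [T] the subalgebra in question, and [N u] the sum of the
    [w.u] over all permutations [w] (the transfer).

    The trace form [M |-> t (tr M)] is symmetrizing on matrices and lives in
    degree 2, so its [d]-th tensor power [tau] is a symmetric, nondegenerate,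
    permutation-invariant form on [E]; the signs of the superalgebra cancel
    because a nonzero value forces equal parities place by place. For an index
    [x], let [H_x] be the group of permutations that fix [x] and only move
    places where [x] has degree 2. Its order is the coefficient [eta_coef x]
    of the definition of [T], hence [T] is the set of the invariants [u] such
    that [#|H_x|] divides the coordinate [u_x] for every [x] ([T_algP]). In
    this form each property of [T] is a count of orbits: if a finite group [G]
    acts on the terms of a sum and the order of each stabilizer divides the
    corresponding term, then [#|G|] divides the sum ([nat_dvd_sum_act]). Thus
    [T] is closed under multiplication ([T_algM]), contains all transfers
    ([T_alg_transfer]), and [tau] takes values in [d! k] on it
    ([T_alg_form_dvd]).

    [T] is self-dual for [tau / d!] ([T_alg_unimodular]): a linear form [f] on
    [T] gives the linear form [f (N u)] on [E], which is [tau (z * u)] for some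
    [z] of [E]. The invariance of [N] puts [z] in [S], and the coordinates of
    [z] are the values of [f] at the transfers of the dual basis vectors, which
    are divisible enough for [z] to be in [T]. On [T] itself [N] is
    multiplication by [d!].

    Maximality ([symmetric_overalgebra_sub_T]): let [C] be a symmetric
    subalgebra between [T] and [S], with form [theta]. By self-duality of [T],
    [d! theta v = tau (z * v)] for some [z] of [T], first on [T], then on [C],
    and [z] is central. If [z] is invertible in [T], then for [u] in [C] and
    [v] in [T] the scalar [tau (u * v) = d! theta (z^-1 * u * v)] is in [d! k],
    so [u] is in [T] by self-duality. To invert [z], use [d <= n]: let [U_rs]
    be the pure tensor whose factor at the place [i] is the matrix unit at
    [(r i, s i)], and let [omega] be an injective sequence of indices. The
    self-duality of [C] applied to [v |-> tau (U_(omega, omega) * v)] yields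
    [y] in [C] such that [z * y = N U_(omega, omega)]. Since
    [N U_(r, omega) * U_(omega, s) = U_rs], the element [y'] which is the sum
    over [r] of [N U_(r, omega) * y * U_(omega, r)] satisfies [z * y' = 1] in
    [E]. Finally [y'] is integral over [k], by Cayley-Hamilton, and an integral
    inverse of [z] is a polynomial in [z], so it lies in [T]
    ([subalgebra_inv]). *)

(** * Signs of place permutations *)

Section Signs.
Variables (R : comNzRingType) (d : nat).
Implicit Types (a b : 'I_d -> bool) (v w : 'S_d).

(** The sign of a product of two pure tensors with parities [a] and [b]. *)
Definition cross_sign a b : R :=
  \prod_(i < d) \prod_(j < d | (j < i)%N) (-1) ^+ (a i && b j).

(** The sign of the place permutation [w] on a pure tensor of parities [a]. *)
Definition inv_sign w a : R :=
  \prod_(i < d) \prod_(j < d | (i < j)%N && (w j < w i)%N)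
    (-1) ^+ (a (w i) && a (w j)).

Let sg (f : 'I_d -> 'I_d -> bool) : R :=
  \prod_(q : 'I_d * 'I_d) (-1) ^+ f q.1 q.2.

Let sgE f : sg f = \prod_i \prod_j (-1) ^+ f i j.
Proof. by rewrite pair_bigA. Qed.

Let sgM f g : sg f * sg g = sg (fun i j => f i j (+) g i j).
Proof. by rewrite -big_split; apply: eq_bigr => q _; rewrite /= signr_addb. Qed.

Let eq_sg f g : (forall i j, f i j = g i j) -> sg f = sg g.
Proof. by move=> fg; apply: eq_bigr => q _; rewrite fg. Qed.

Let sg_swap f : sg (fun i j => f j i) = sg f.
Proof.
rewrite [RHS](reindex_inj (h := fun q => (q.2, q.1))) //.
by move=> [i j] [i' j'] /= [-> ->].
Qed.

Let sg_perm w f : sg (fun i j => f (w i) (w j)) = sg f.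
Proof.
rewrite [RHS](reindex_inj (h := fun q => (w q.1, w q.2))) //.
by move=> [i j] [i' j'] /= [/perm_inj -> /perm_inj ->].
Qed.

Let sg_false f : (forall i j, f i j = false) -> sg f = 1.
Proof. by move=> f0; apply: big1 => q _; rewrite f0. Qed.

(** An unordered pair [{i, j}] contributes [h i j] and [h j i] twice each. *)
Let sg_sym f h : (forall i j, f i j = h i j (+) h j i) -> sg f = 1.
Proof.
move=> fh; rewrite (eq_sg fh) -sgM [X in _ * X]sg_swap sgM.
by apply: sg_false => i j; rewrite addbb.
Qed.

Let sg_inv f g : sg (fun i j => f i j (+) g i j) = 1 -> sg f = sg g.
Proof.
move=> fg1; rewrite -[RHS]mul1r -fg1 -sgM -mulrA sgM.
by rewrite [X in _ * X]sg_false ?mulr1 // => i j; rewrite addbb.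
Qed.

Let cross_sg a b : cross_sign a b = sg (fun i j => [&& (j < i)%N, a i & b j]).
Proof.
rewrite sgE; apply: eq_bigr => i _; rewrite big_mkcond.
by apply: eq_bigr => j _; case: ifP.
Qed.

Let inv_sg w a : inv_sign w a =
  sg (fun i j => [&& (i < j)%N && (w j < w i)%N, a (w i) & a (w j)]).
Proof.
rewrite sgE; apply: eq_bigr => i _; rewrite big_mkcond.
by apply: eq_bigr => j _; case: ifP.
Qed.

(** A pair is inverted by the product when one, but not both, of the factors
    inverts it. This is what makes the signed place permutations an action. *)
Lemma inv_signM v w a :
  inv_sign (v * w)%g a = inv_sign w a * inv_sign v (fun i => a (w i)).
Proof.
rewrite !inv_sg -[X in _ = X * _](sg_perm v) sgM; apply: sg_inv.
apply: (sg_sym (h := fun i j => [&& (j < i)%N, (v i < v j)%N,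
  (w (v j) < w (v i))%N, a (w (v i)) & a (w (v j))])) => i j.
rewrite !permM; have [->|/eqP ne] := eqVneq i j; first by rewrite !ltnn.
case: (ltngtP i j) => [||/val_inj //] _;
  case: (ltngtP (v i) (v j)) => [||/val_inj/perm_inj //] _;
  case: (ltngtP (w (v i)) (w (v j))) => [||/val_inj/perm_inj/perm_inj //] _;
  by case: (a (w (v i))) (a (w (v j))) => [] [].
Qed.

(** The exponent of [inv_sign w] is a quadratic form in the parities, whose
    polar form is the change of the exponent of [cross_sign] under [w]. This
    is why signed place permutations are multiplicative. *)
Lemma inv_sign_addb w a b :
  inv_sign w (fun i => a i (+) b i) * cross_sign a b =
    inv_sign w a * inv_sign w b
      * cross_sign (fun i => a (w i)) (fun i => b (w i)).
Proof.
rewrite !inv_sg !cross_sg -[X in _ * X = _](sg_perm w) !sgM; apply: sg_inv.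
apply: (sg_sym (h := fun i j => [&& (i < j)%N, (w j < w i)%N,
  b (w i) & a (w j)])) => i j.
have [->|/eqP ne] := eqVneq i j; first by rewrite !ltnn.
case: (ltngtP i j) => [||/val_inj //] _;
  case: (ltngtP (w i) (w j)) => [||/val_inj/perm_inj //] _;
  by case: (a (w i)) (a (w j)) (b (w i)) (b (w j)) => [] [] [] [].
Qed.

Lemma eq_cross_sign a a' b b' :
  a =1 a' -> b =1 b' -> cross_sign a b = cross_sign a' b'.
Proof.
by move=> ea eb; rewrite !cross_sg; apply: eq_sg => i j; rewrite ea eb.
Qed.

Lemma eq_inv_sign w a a' : a =1 a' -> inv_sign w a = inv_sign w a'.
Proof. by move=> ea; rewrite !inv_sg; apply: eq_sg => i j; rewrite !ea. Qed.

Lemma cross_sign0 b : cross_sign (fun=> false) b = 1.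
Proof. by rewrite cross_sg; apply: sg_false => i j; rewrite andbF. Qed.

Lemma cross_sign_sqr a b : cross_sign a b * cross_sign a b = 1.
Proof. by rewrite cross_sg sgM; apply: sg_false => i j; rewrite addbb. Qed.

Lemma inv_sign_sqr w a : inv_sign w a * inv_sign w a = 1.
Proof. by rewrite inv_sg sgM; apply: sg_false => i j; rewrite addbb. Qed.

Lemma inv_sign_fix w a : (forall i, a (w i) -> w i = i) -> inv_sign w a = 1.
Proof.
move=> wa; rewrite inv_sg; apply: sg_false => i j; apply/negP.
by case/and3P=> /andP[ij wji] /wa ei /wa ej;
  rewrite ei ej ltnNge (ltnW ij) in wji.
Qed.

End Signs.

(** * Tensors in coordinates *)

Section PlacePermutation.
Variables (d : nat) (X : Type).
Implicit Types (x : {ffun 'I_d -> X}) (w : 'S_d).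

Definition xperm w x : {ffun 'I_d -> X} := [ffun i => x (w i)].

Lemma xperm1 x : xperm 1%g x = x.
Proof. by apply/ffunP => i; rewrite ffunE perm1. Qed.

Lemma xpermM w w' x : xperm (w * w')%g x = xperm w (xperm w' x).
Proof. by apply/ffunP => i; rewrite !ffunE permM. Qed.

Lemma xpermK w : cancel (xperm w) (xperm w^-1).
Proof. by move=> x; rewrite -xpermM mulVg xperm1. Qed.

Lemma xpermKV w : cancel (xperm w^-1) (xperm w).
Proof. by move=> x; rewrite -xpermM mulgV xperm1. Qed.

End PlacePermutation.

Section Tensors.
Variables (k : idomainType) (A : graded_algebra k) (B : homog_basis A).
Variables (n d : nat).
Implicit Types (M N : 'M[A]_n) (X Y : 'I_d -> 'M[A]_n) (l m o : mx_idx B n).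
Implicit Types (a b : 'I_d -> bool).
Local Notation mi := {ffun 'I_d -> mx_idx B n}.
Local Notation E := (tens B n d).
Implicit Types (u v : E) (x y z : mi) (w : 'S_d).

Lemma mx_coord_sum (J : finType) (P : pred J) (F : J -> 'M[A]_n) l :
  mx_coord l (\sum_(j | P j) F j) = \sum_(j | P j) mx_coord l (F j).
Proof. by rewrite /mx_coord summxE linear_sum. Qed.

Lemma mx_coord_scal (c : k) M l :
  mx_coord l (map_mx ( *:%R c) M) = c * mx_coord l M.
Proof. by rewrite /mx_coord mxE linearZ. Qed.

Lemma mx_coord_vecE l m : mx_coord m (mx_vec l) = (l == m)%:R.
Proof.
case: l m => [[b r] s] [[b' r'] s']; rewrite /mx_coord mxE /=.
rewrite !xpair_eqE [r' == _]eq_sym [s' == _]eq_sym.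
by case: ifP => [/andP[-> ->]|]; rewrite ?andbT ?hb_coord_vec // -andbA => ->;
  rewrite andbF linear0.
Qed.

Lemma mx_coord_inj M N : (forall l, mx_coord l M = mx_coord l N) -> M = N.
Proof.
move=> eMN; apply/matrixP => r s; rewrite -(hb_coordK B (M r s)).
rewrite -(hb_coordK B (N r s)); apply: eq_bigr => b _; congr (_ *: _).
exact: (eMN (b, r, s)).
Qed.

Lemma mx_coordK M :
  \sum_(l : mx_idx B n) map_mx ( *:%R (mx_coord l M)) (mx_vec l) = M.
Proof.
apply: mx_coord_inj => l; rewrite mx_coord_sum (bigD1 l) //= mx_coord_scal.
rewrite mx_coord_vecE eqxx mulr1 big1 ?addr0 // => m ne.
by rewrite mx_coord_scal mx_coord_vecE (negbTE ne) mulr0.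
Qed.

Lemma map_scal_mulmx (c c' : k) M N :
  map_mx ( *:%R c) M *m map_mx ( *:%R c') N = map_mx ( *:%R (c * c')) (M *m N).
Proof.
apply/matrixP => r s; rewrite !mxE scaler_sumr; apply: eq_bigr => p _.
by rewrite !mxE -kalg_scaleAl -kalg_scaleAr scalerA.
Qed.

Lemma mx_coord_mul o M N : mx_coord o (M *m N) =
  \sum_(l : mx_idx B n) \sum_(m : mx_idx B n)
     mx_coord l M * mx_coord m N * mx_mul_coef l m o.
Proof.
rewrite -{1}(mx_coordK M) -{1}(mx_coordK N) mulmx_suml mx_coord_sum.
apply: eq_bigr => l _; rewrite mulmx_sumr mx_coord_sum.
by apply: eq_bigr => m _; rewrite map_scal_mulmx mx_coord_scal.
Qed.

Lemma mx_mul_comp l m r s :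
  ga_comp A (hb_deg l.1.1 + hb_deg m.1.1) ((mx_vec l *m mx_vec m) r s).
Proof.
rewrite mxE; have [z addc] := ga_submodule A (hb_deg l.1.1 + hb_deg m.1.1).
apply: (big_ind (ga_comp A _)) => // [p q hp hq|t _].
  by rewrite -[p]scale1r; apply: addc.
rewrite !mxE; case: ifP => _; last by rewrite mul0r.
case: ifP => _; last by rewrite mulr0.
by apply: ga_mul; apply: hb_vec_comp.
Qed.

Lemma mx_mul_deg l m o : mx_coord o (mx_vec l *m mx_vec m) != 0 ->
  hb_deg o.1.1 = (hb_deg l.1.1 + hb_deg m.1.1)%N :> nat.
Proof. by move=> nz; apply: (hb_coord_deg _ nz); apply: mx_mul_comp. Qed.

Lemma tens_coord_inj u v : tens_coord u =1 tens_coord v -> u = v.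
Proof. by move=> uv; apply/ffunP. Qed.

Lemma tens_coordD u v x :
  tens_coord (u + v) x = tens_coord u x + tens_coord v x.
Proof. by rewrite /tens_coord /= ffunE. Qed.

Lemma tens_coordZ c u x : tens_coord (c *: u) x = c * tens_coord u x.
Proof. by rewrite /tens_coord /= ffunE. Qed.

Lemma tens_coord0 x : tens_coord (0 : E) x = 0.
Proof. by rewrite /tens_coord /= ffunE. Qed.

Lemma tens_coord_sum (J : Type) (r : seq J) (P : pred J) (F : J -> E) x :
  tens_coord (\sum_(j <- r | P j) F j) x
    = \sum_(j <- r | P j) tens_coord (F j) x.
Proof.
apply: (big_morph (fun u => tens_coord u x)) => [u v|].
  exact: tens_coordD.
exact: tens_coord0.
Qed.

Lemma tens_coord_pure X x :
  tens_coord (pure_tens B X) x = \prod_i mx_coord (x i) (X i).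
Proof. by rewrite /tens_coord ffunE. Qed.

Lemma tens_coordK u : \sum_x tens_coord u x *: tens_vec x = u.
Proof.
apply: tens_coord_inj => x; rewrite tens_coord_sum (bigD1 x) //=.
rewrite tens_coordZ tens_coord_vec eqxx mulr1 big1 ?addr0 // => y ne.
by rewrite tens_coordZ tens_coord_vec (negbTE ne) mulr0.
Qed.

Lemma tens1E : 1 = pure_tens B (fun=> 1%:M) :> E.
Proof. by apply: tens_coord_inj => x; rewrite !tens_coord_pure. Qed.

Lemma eq_pure_tens X Y : X =1 Y -> pure_tens B X = pure_tens B Y.
Proof.
move=> eXY; apply: tens_coord_inj => x; rewrite !tens_coord_pure.
by apply: eq_bigr => i _; rewrite eXY.
Qed.

Lemma tens_mul_sum u v :
  u * v = \sum_x \sum_y (tens_coord u x * tens_coord v y) *: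
            (tens_vec x * tens_vec y).
Proof.
rewrite -{1}(tens_coordK u) -{1}(tens_coordK v) mulr_suml.
apply: eq_bigr => x _; rewrite mulr_sumr; apply: eq_bigr => y _.
by rewrite -kalg_scaleAl -kalg_scaleAr scalerA.
Qed.

(** Homogeneity place by place; the zero matrix has both parities. *)
Definition pure_parity X a :=
  forall i l, mx_coord l (X i) != 0 -> mx_odd l = a i.

Lemma pure_parityP X a x :
  pure_parity X a -> \prod_i mx_coord (x i) (X i) != 0 ->
  forall i, mx_odd (x i) = a i.
Proof. by move=> Xa /prodf_neq0 nz i; apply: Xa; apply: nz. Qed.

Lemma mx_vec_parity x :
  pure_parity (fun i => mx_vec (x i)) (fun i => mx_odd (x i)).
Proof.
by move=> i l; rewrite mx_coord_vecE; case: (x i =P l) => [->|]; rewrite ?eqxx.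
Qed.

(** The superalgebra product of pure tensors whose factors need not be basis
    matrices, such as unit matrices and dual basis elements. *)
Lemma pure_tensM X Y a b : pure_parity X a -> pure_parity Y b ->
  pure_tens B X * pure_tens B Y =
    cross_sign k a b *: pure_tens B (fun i => X i *m Y i).
Proof.
move=> Xa Yb; apply: tens_coord_inj => z.
rewrite tens_coordZ tens_coord_pure [LHS]tw_mulE.
under [in RHS]eq_bigr => i _ do rewrite mx_coord_mul.
rewrite (bigA_distr_bigA (fun i l => \sum_j mx_coord l (X i) * mx_coord j (Y i)
  * mx_mul_coef l j (z i))) mulr_sumr; apply: eq_bigr => x _.
rewrite (bigA_distr_bigA (fun i j => mx_coord (x i) (X i) * mx_coord j (Y i)
  * mx_mul_coef (x i) j (z i))) mulr_sumr; apply: eq_bigr => y _.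
rewrite !big_split /= !ffunE mulrA; congr (_ * _); rewrite mulrC.
have [->|nzX] := eqVneq (\prod_i mx_coord (x i) (X i)) 0.
  by rewrite !mul0r !mulr0.
have [->|nzY] := eqVneq (\prod_i mx_coord (y i) (Y i)) 0.
  by rewrite !mulr0.
by congr (_ * _); apply: eq_cross_sign;
  [apply: pure_parityP nzX|apply: pure_parityP nzY].
Qed.

Lemma perm_signE w x : perm_sign w x = inv_sign k w (fun i => mx_odd (x i)).
Proof. by []. Qed.

Lemma perm_signM w w' x :
  perm_sign (w * w')%g x = perm_sign w' x * perm_sign w (xperm w' x).
Proof.
rewrite !perm_signE inv_signM; congr (_ * _).
by apply: eq_inv_sign => i; rewrite ffunE.
Qed.

Lemma perm_sign_sqr w x : perm_sign w x * perm_sign w x = 1.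
Proof. by rewrite perm_signE inv_sign_sqr. Qed.

Lemma perm_sign_fix w x :
  (forall i, mx_odd (x (w i)) -> w i = i) -> perm_sign w x = 1.
Proof. by move=> wx; rewrite perm_signE inv_sign_fix. Qed.

Lemma perm_act_coord w u x :
  tens_coord (perm_act w u) (xperm w x) = perm_sign w x * tens_coord u x.
Proof.
rewrite tens_coord_sum (bigD1 x) //= tens_coordZ tens_coord_vec eqxx mulr1.
rewrite mulrC big1 ?addr0 // => y ne; rewrite tens_coordZ tens_coord_vec.
by rewrite (can_eq (xpermK w)) (negbTE ne) mulr0.
Qed.

Lemma perm_act_linear w (c : k) u v :
  perm_act w (c *: u + v) = c *: perm_act w u + perm_act w v.
Proof.
apply: tens_coord_inj => x; rewrite -(xpermKV w x) tens_coordD tens_coordZ.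
by rewrite !perm_act_coord tens_coordD tens_coordZ; ring.
Qed.

HB.instance Definition _ w :=
  GRing.isLinear.Build k E E *:%R (@perm_act k A B n d w) (perm_act_linear w).

Lemma perm_act1 u : perm_act 1%g u = u.
Proof.
apply: tens_coord_inj => x; rewrite -{1}(xperm1 x) perm_act_coord.
by rewrite perm_sign_fix ?mul1r // => i; rewrite perm1.
Qed.

Lemma perm_actM w w' u : perm_act (w * w')%g u = perm_act w (perm_act w' u).
Proof.
apply: tens_coord_inj => x; rewrite -(xpermKV (w * w') x) perm_act_coord.
by rewrite xpermM !perm_act_coord perm_signM; ring.
Qed.

Lemma perm_actK w : cancel (perm_act w) (perm_act w^-1 : E -> E).
Proof. by move=> u; rewrite -perm_actM mulVg perm_act1. Qed.

Lemma perm_act_pure w X a : pure_parity X a ->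
  perm_act w (pure_tens B X) = inv_sign k w a *: pure_tens B (fun i => X (w i)).
Proof.
move=> Xa; apply: tens_coord_inj => x; rewrite -(xpermKV w x) perm_act_coord.
rewrite tens_coordZ !tens_coord_pure; set y := xperm _ x.
have <- : \prod_i mx_coord (y i) (X i) =
    \prod_i mx_coord (xperm w y i) (X (w i)).
  rewrite [LHS](reindex_inj (@perm_inj _ w)).
  by apply: eq_bigr => i _; rewrite [in RHS]ffunE.
have [->|nz] := eqVneq (\prod_i mx_coord (y i) (X i)) 0;
  first by rewrite !mulr0.
by congr (_ * _); rewrite perm_signE; apply: eq_inv_sign;
  apply: pure_parityP nz.
Qed.

Lemma perm_act_mul w u v : perm_act w (u * v) = perm_act w u * perm_act w v.
Proof.
rewrite tens_mul_sum -[in RHS](tens_coordK u) -[in RHS](tens_coordK v).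
rewrite !linear_sum big_distrl; apply: eq_bigr => x _ /=.
rewrite big_distrr linear_sum; apply: eq_bigr => y _ /=.
rewrite !linearZ -kalg_scaleAl -kalg_scaleAr scalerA /=; congr (_ *: _).
rewrite !perm_act_vec -kalg_scaleAl -kalg_scaleAr !tens_mul_vec linearZ /=.
set a := fun i => mx_odd (x i); set b := fun i => mx_odd (y i).
have par : pure_parity (fun i => mx_vec (x i) *m mx_vec (y i))
    (fun i => a i (+) b i).
  by move=> i l nz; rewrite /mx_odd (mx_mul_deg nz) oddD.
rewrite (perm_act_pure w par) !scalerA; congr (_ *: _); last first.
  by apply: eq_pure_tens => i; rewrite !ffunE.
rewrite mulrC [LHS](inv_sign_addb k w a b); congr (_ * _).
by apply: eq_cross_sign => i; rewrite ffunE.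
Qed.

End Tensors.
Arguments mx_vec_parity {k A B n d} x.

(** * Divisibility and Young subgroups *)

Section NatDvd.
Variable R : pzRingType.
Implicit Types c : R.

Definition nat_dvd (m : nat) c := exists a : R, c = a *+ m.

Lemma nat_dvd0 m : nat_dvd m 0.
Proof. by exists 0; rewrite mul0rn. Qed.

Lemma nat_dvdD m c c' : nat_dvd m c -> nat_dvd m c' -> nat_dvd m (c + c').
Proof. by move=> [a ->] [a' ->]; exists (a + a'); rewrite mulrnDl. Qed.

Lemma nat_dvd_sum m (I : Type) (r : seq I) (P : pred I) (F : I -> R) :
  (forall i, P i -> nat_dvd m (F i)) -> nat_dvd m (\sum_(i <- r | P i) F i).
Proof.
by move=> mF; apply: big_ind => //; [apply: nat_dvd0|apply: nat_dvdD].
Qed.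

Lemma nat_dvd_mull m c c' : nat_dvd m c' -> nat_dvd m (c * c').
Proof. by move=> [a ->]; exists (c * a); rewrite mulrnAr. Qed.

Lemma nat_dvd_trans m m' c : (m %| m')%N -> nat_dvd m' c -> nat_dvd m c.
Proof. by move=> /dvdnP[q ->] [a ->]; exists (a *+ q); rewrite mulrnA. Qed.

End NatDvd.

Section ActionSum.
Variables (gT : finGroupType) (G : {group gT}) (X : finType) (R : pzRingType).
Variables (act : gT -> X -> X) (f : X -> R).
Hypothesis act1 : forall x, act 1%g x = x.
Hypothesis actM : forall g h x, act (g * h)%g x = act g (act h x).
Hypothesis f_inv : forall g x, g \in G -> f (act g x) = f x.
Hypothesis f_stab :
  forall x, nat_dvd #|[set g in G | act g x == x]| (f x).

(** On the orbit of [x] the sum is [f x] times the index of the stabilizer. *)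
Lemma nat_dvd_sum_act : nat_dvd #|G| (\sum_x f x).
Proof.
pose to0 x g := act g^-1%g x.
have to0_act : is_action [set: gT] to0.
  apply: is_total_action => [x|x g h]; rewrite /to0; first by rewrite invg1.
  by rewrite invMg actM.
pose to := Action to0_act.
have actsG : [acts G, on [set: X] | to].
  by apply/subsetP => g _; rewrite !inE; apply/subsetP => x _; rewrite !inE.
rewrite (eq_bigl (fun x => x \in [set: X])) => [|x]; last by rewrite !inE.
rewrite (finset.set_partition_big _ (orbit_partition actsG)) /=.
apply: nat_dvd_sum => O /imsetP[x _ ->].
rewrite (eq_bigr (fun=> f x)) => [|y /imsetP[g Gg ->]]; last first.
  by rewrite /= /to0 f_inv ?groupV.
rewrite sumr_const -(card_orbit_stab to G x) mulnC.
have [a ->] := f_stab x; exists a; rewrite -mulrnA; congr (_ *+ (_ * _)).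
apply: eq_card => g; rewrite !inE /= sub1set inE /= /to0.
congr andb; apply/eqP/eqP => e; first by rewrite -{1}e -actM mulVg act1.
by rewrite -{1}e -actM mulgV act1.
Qed.

End ActionSum.

Section YoungSubgroup.
Variables (T X : finType) (f : T -> X).
Implicit Types (s : pred X) (w : {perm T}).

(** A Young subgroup: the product of the symmetric groups of the fibres of [f]
    over [s]. *)
Definition young s : {set {perm T}} :=
  [set w : {perm T} | [forall i, (f (w i) == f i) && ((w i == i) || s (f i))]].

Lemma youngP s w :
  reflect ((forall i, f (w i) = f i) /\ (forall i, w i != i -> s (f i)))
          (w \in young s).
Proof.
rewrite inE; apply: (iffP forallP) => [h|[h1 h2] i].
  split=> i; have /andP[/eqP //] := h i.
  by move=> _ /orP[/eqP ->|//]; rewrite eqxx.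
by rewrite h1 eqxx /=; case: eqVneq => //= ne; apply: h2.
Qed.

Lemma young_group_set s : group_set (young s).
Proof.
apply/group_setP; split.
  by apply/youngP; split=> i; rewrite perm1 ?eqxx.
move=> v w /youngP[v1 v2] /youngP[w1 w2]; apply/youngP; split=> i;
    rewrite permM.
  by rewrite w1 v1.
have [->|/v2 //] := eqVneq (v i) i; exact: w2.
Qed.

Canonical young_group s := Group (young_group_set s).

Lemma young_fix s w i : w \in young s -> ~~ s (f i) -> w i = i.
Proof. by move=> /youngP[_ h] ns; apply: contraNeq ns; apply: h. Qed.

Let fib a := [set i | f i == a].

(** A permutation that preserves [f] splits into its restriction to the fibre
    of [a] and a permutation that fixes this fibre. *)
Lemma young_cons s a : ~~ s a ->
  #|young (predU1 a s)| = ((#|fib a|)`! * #|young s|)%N.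
Proof.
move=> sa; rewrite -card_perm -[#|perm_on _|]/#|[pred w | perm_on (fib a) w]|.
have -> : #|[pred w | perm_on (fib a) w]| = #|Sym (fib a)|.
  by apply: eq_card => w; rewrite !inE.
rewrite -TI_cardMg; last first.
  apply/trivgP/subsetP => w; rewrite !inE => /andP[on_w yw].
  apply/eqP/permP => i; rewrite perm1.
  have [fi|nfi] := boolP (i \in fib a); last exact: out_perm on_w nfi.
  apply: (@young_fix s); first by rewrite inE.
  by move: fi; rewrite inE => /eqP ->.
apply: eq_card => w; apply/idP/idP.
  move=> /youngP[w1 w2].
  have Nw : w \in 'N(fib a | 'P).
    by apply/astabsP => i /=; rewrite !inE /= apermE w1.
  set p := restr_perm (fib a) w.
  have on_p : perm_on (fib a) p by apply: restr_perm_on.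
  apply/mulsgP; exists p (p^-1 * w)%g; rewrite ?mulKVg // ?inE //.
  have fix_q i : i \in fib a -> (p^-1 * w)%g i = i.
    move=> fi; rewrite permM; have fi' : p^-1%g i \in fib a.
      by rewrite -(perm_closed _ on_p) permKV.
    by rewrite -(restr_permE Nw fi') permKV.
  have out_q i : i \notin fib a -> (p^-1 * w)%g i = w i.
    move=> nfi; rewrite permM; congr (w _); apply: (canLR (permK p)).
    by rewrite (out_perm on_p).
  apply/forallP => i; have [fi|nfi] := boolP (i \in fib a).
    by rewrite fix_q // !eqxx.
  rewrite out_q // w1 eqxx /=; case: eqVneq => //= ne.
  by have /orP[|//] := w2 i ne; rewrite inE in nfi; rewrite (negbTE nfi).
move=> /mulsgP[p q]; rewrite inE => on_p yq ->.
apply: (@groupM _ (young_group _)); apply/youngP.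
  split=> i.
    have [fi|nfi] := boolP (i \in fib a); last by rewrite (out_perm on_p).
    have := fi; rewrite -(perm_closed i on_p) inE => /eqP ->.
    by move: fi; rewrite inE => /eqP.
  move=> ne; apply/orP; left; move: ne; apply: contraNT => nfi.
  by rewrite (out_perm on_p) ?inE.
have [q1 q2] := youngP _ _ yq; split=> // i /q2 si.
by apply/orP; right.
Qed.

Lemma card_young s :
  #|young s| = (\prod_(a | s a) (#|[pred i | f i == a]|)`!)%N.
Proof.
transitivity (\prod_(a <- enum s) (#|fib a|)`!)%N; last first.
  rewrite big_enum; apply: eq_bigr => a _; congr (_`!).
  by apply: eq_card => i; rewrite !inE.
have -> : #|young s| = #|young (mem (enum s))|.
  apply: eq_card => w; rewrite !inE; apply: eq_forallb => i.
  by rewrite [mem _ _]mem_enum.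
elim: (enum s) (enum_uniq s) => [_|a r IHr /= /andP[ar /IHr e]].
  rewrite big_nil -[RHS](cards1 (1%g : {perm T})); apply: eq_card => w.
  rewrite in_set1; apply/idP/eqP => [yw|->];
    last exact: (group1 (young_group _)).
  by apply/permP => i; rewrite perm1; apply: (young_fix yw).
by rewrite big_cons -e -young_cons.
Qed.

End YoungSubgroup.

(** The restriction to [D] maps [K] to [H1] with kernel inside [H2]. *)
Lemma dvdn_card_restr (T : finType) (D : {set T}) (K H1 H2 : {group {perm T}}) :
  K \subset 'N(D | 'P) ->
  (forall w, w \in K -> restr_perm D w \in H1) ->
  (forall w, w \in K -> restr_perm D w = 1%g -> w \in H2) ->
  (#|K| %| #|H1| * #|H2|)%N.
Proof.
move=> KN K1 K2; pose r := restr_perm_morphism D.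
have -> : #|K| = (#|'ker_K r| * #|r @* K|)%N.
  by rewrite card_morphim (setIidPr KN) LagrangeI.
rewrite mulnC; apply: dvdn_mul; apply: cardSg.
  by apply/subsetP => _ /morphimP[w _ Kw ->]; apply: K1.
apply/subsetP => w; rewrite !inE => /andP[Kw /andP[_ /eqP rw]]; exact: K2.
Qed.

Local Open Scope classical_set_scope.

(** * Lattices of invariant tensors *)

Lemma linear_onZ (k : idomainType) (V : lmodType k) (U : set V) (f : V -> k) :
  is_submodule U -> linear_on U f ->
  forall c v, U v -> f (c *: v) = c * f v.
Proof.
move=> [U0 _] fL c v Uv.
have f0 : f 0 = 0.
  by have := fL (-1) 0 0 U0 U0; rewrite scaler0 addr0 mulN1r addNr.
by rewrite -[_ *: v]addr0 fL // f0 addr0.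
Qed.

Lemma is_basis_has_rank (k : idomainType) (V : lmodType k) (I : finType)
    (P : pred I) (v : I -> V) (U : set V) :
  is_basis P v U -> has_rank U #|P|.
Proof.
have sumE (F : I -> V) : \sum_(i | P i) F i = \sum_(j < #|P|) F (enum_val j).
  exact: big_enum_val.
move=> [-> v_free]; exists (fun j => v (enum_val j)); split.
  apply/seteqP; split=> _ [c _ <-].
    by exists (fun j => c (enum_val j)); rewrite ?sumE.
  have [i0 Pi0|P0] := pickP P; last first.
    exists (fun=> 0) => //; rewrite big_pred0 // big1 // => j _.
    by have := enum_valP j; rewrite -topredE /= P0.
  exists (fun i => c (enum_rank_in Pi0 i)) => //; rewrite sumE.
  by apply: eq_bigr => j _; rewrite enum_valK_in.
move=> c c0 j _; pose c' i := c (enum_rank_in (enum_valP j) i).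
rewrite -(enum_valK_in (enum_valP j) j); apply: (v_free c').
  rewrite sumE -[RHS]c0.
  by apply: eq_bigr => j' _; rewrite /c' enum_valK_in.
exact: (enum_valP j).
Qed.

Section Lattices.
Variables (k : idomainType) (A : graded_algebra k) (B : homog_basis A).
Variables (n d : nat).
Hypothesis k_char0 : forall m : nat, (0 < m)%N -> m%:R != 0 :> k.
Local Notation mi := {ffun 'I_d -> mx_idx B n}.
Local Notation E := (tens B n d).
Implicit Types (u v : E) (x y z : mi) (w : 'S_d).

Lemma S_algP u : S_alg B n d u <->
  forall w x, tens_coord u (xperm w x) = perm_sign w x * tens_coord u x.
Proof.
split=> [Su w x|h w]; first by rewrite -perm_act_coord Su.
by apply: tens_coord_inj => x; rewrite -(xpermKV w x) perm_act_coord [RHS]h.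
Qed.

(** A permutation that fixes such an index fixes every odd place. *)
Lemma Tri_perm_sign x w : Tri x -> xperm w x = x -> perm_sign w x = 1.
Proof.
move=> /forallP Tx wx; apply: perm_sign_fix => i odd_xi.
apply/eqP; apply: contraTT odd_xi => ne.
have /forallP/(_ i)/implyP := Tx (w i); apply; rewrite ne /=.
by have <- : xperm w x i = x i; [rewrite wx|rewrite ffunE].
Qed.

(** An index with a repeated odd entry can be moved to one where the repeated
    entries are adjacent; their exchange then fixes the index and changes the
    sign. *)
Lemma S_alg_Tri u x : S_alg B n d u -> tens_coord u x != 0 -> Tri x.
Proof.
move=> /S_algP Su; apply: contraNT; rewrite negb_forall => /existsP[i].
rewrite negb_forall => /existsP[j]; rewrite negb_imply negbK.
move=> /andP[/andP[ne /eqP xij] odd_x].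
wlog ij : i j ne xij odd_x / (i < j)%N => [wl|].
  case: (ltngtP i j) => [|ji|/val_inj e]; first exact: wl.
    by apply: (wl j i) => //; rewrite ?xij // -?xij // eq_sym.
  by rewrite e eqxx in ne.
have [i' ii'] : exists i' : 'I_d, i' = i.+1 :> nat.
  by exists (Ordinal (leq_ltn_trans ij (ltn_ord j))).
pose y := xperm (tperm i' j) x.
have yi : y i = x i.
  by rewrite ffunE tpermD // -val_eqE /= ?ii' ?gtn_eqF ?ltnS.
have yi' : y i' = x i by rewrite ffunE tpermL.
have ty : xperm (tperm i i') y = y.
  by apply/ffunP => l; rewrite [LHS]ffunE; case: tpermP => // ->;
    rewrite ?yi ?yi'.
have := Su (tperm i i') y.
rewrite ty perm_sign_tperm // yi yi' odd_x /= expr1 mulN1r => /eqP.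
rewrite -addr_eq0 -mulr2n -mulr_natr mulf_eq0 (negbTE (k_char0 _)) // orbF.
rewrite Su mulf_eq0 => /orP[/eqP s0|//].
have := perm_sign_sqr (tperm i' j) x.
by rewrite s0 mul0r => /eqP; rewrite eq_sym oner_eq0.
Qed.

Definition in_orb x y := [exists w, y == xperm w x].

Lemma in_orb_xperm x w : in_orb x (xperm w x).
Proof. by apply/existsP; exists w. Qed.

Lemma in_orb_sym x y : in_orb x y = in_orb y x.
Proof.
by apply/existsP/existsP => -[w /eqP ->]; exists w^-1%g; rewrite xpermK.
Qed.

Lemma in_orb_trans x y z : in_orb x y -> in_orb y z -> in_orb x z.
Proof.
by move=> /existsP[w /eqP ->] /existsP[w' /eqP ->];
  rewrite -xpermM in_orb_xperm.
Qed.

Lemma Tri_xperm w x : Tri x -> Tri (xperm w x).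
Proof.
move=> /forallP Tx; apply/forallP => i; apply/forallP => j; apply/implyP.
rewrite !ffunE => /andP[ne eij]; have /forallP/(_ (w j))/implyP := Tx (w i).
by apply; rewrite (inj_eq perm_inj) ne.
Qed.

(** The terms [w.e_x] with [x o w] fixed coincide, by [Tri_perm_sign], so
    exactly one of the distinct terms contributes to a coordinate. *)
Lemma xi_coord x w : Tri x -> tens_coord (xi x) (xperm w x) = perm_sign w x.
Proof.
move=> Tx; rewrite /xi; set r := undup _.
have wr : perm_act w (tens_vec x) \in r.
  by rewrite mem_undup; apply: image_f.
rewrite tens_coord_sum (bigD1_seq _ wr (undup_uniq _)) /=.
rewrite perm_act_coord tens_coord_vec eqxx mulr1 big_seq_cond big1 ?addr0 //.
move=> u /andP[]; rewrite mem_undup => /imageP[w' _ ->] ne.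
rewrite perm_act_vec tens_coordZ tens_coord_vec.
have [e|] := eqVneq; last by rewrite mulr0.
case/negP: ne; apply/eqP; rewrite !perm_act_vec.
have -> : [ffun i => x (w i)] = [ffun i => x (w' i)] by rewrite e.
congr (_ *: _); have {}e : xperm w' x = xperm w x := e.
have -> : w' = (w * (w^-1 * w'))%g by rewrite mulKVg.
rewrite perm_signM.
have st : xperm (w^-1 * w') x = x by rewrite xpermM e xpermK.
by rewrite (Tri_perm_sign Tx st) mul1r st.
Qed.

Lemma xi_coord0 x y : ~~ in_orb x y -> tens_coord (xi x) y = 0.
Proof.
move=> nxy; rewrite tens_coord_sum big_seq big1 // => u.
rewrite mem_undup => /imageP[w _ ->]; rewrite perm_act_vec tens_coordZ.
rewrite tens_coord_vec; case: eqP => [e|_]; last by rewrite mulr0.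
by case/negP: nxy; rewrite -e in_orb_xperm.
Qed.

Lemma S_alg_xi x : Tri x -> S_alg B n d (xi x).
Proof.
move=> Tx; apply/S_algP => w y; have [|nxy] := boolP (in_orb x y).
  by move=> /existsP[v /eqP ->]; rewrite -xpermM !xi_coord // perm_signM mulrC.
rewrite !xi_coord0 ?mulr0 //; apply: contra nxy => /in_orb_trans; apply.
by rewrite in_orb_sym in_orb_xperm.
Qed.

Definition orb_rep x := odflt x [pick y | in_orb x y].

Lemma in_orb_rep x : in_orb x (orb_rep x).
Proof.
rewrite /orb_rep; case: pickP => [y //|/(_ x)].
by rewrite -{2}(xperm1 x) in_orb_xperm.
Qed.

Lemma orb_rep_eq x y : in_orb x y -> orb_rep x = orb_rep y.
Proof.
move=> xy; rewrite /orb_rep.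
have -> : [pick z | in_orb x z] = [pick z | in_orb y z].
  apply: eq_pick => z; apply/idP/idP; apply: in_orb_trans => //.
  by rewrite in_orb_sym.
by case: pickP => // /(_ x); rewrite in_orb_sym xy.
Qed.

Definition Tri_rep x := Tri x && (orb_rep x == x).

Lemma S_alg_ext u v : S_alg B n d u -> S_alg B n d v ->
  (forall x, Tri_rep x -> tens_coord u x = tens_coord v x) -> u = v.
Proof.
move=> Su Sv uv; apply: tens_coord_inj => y.
have [Ty|nTy] := boolP (Tri y); last first.
  have [-> ->] // : tens_coord u y = 0 /\ tens_coord v y = 0.
  by split; apply: contraNeq nTy; apply: S_alg_Tri.
have := in_orb_rep y; rewrite in_orb_sym => /existsP[w /eqP yE].
rewrite yE; move/S_algP: Su => ->; move/S_algP: Sv => ->.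
have ryE : orb_rep y = xperm w^-1 y by rewrite {2}yE xpermK.
rewrite uv // /Tri_rep {1}ryE Tri_xperm //=.
by rewrite -(orb_rep_eq (in_orb_rep y)).
Qed.

Section Lattice.
Variable m : mi -> nat.
Hypothesis m_gt0 : forall x, (0 < m x)%N.
Hypothesis m_perm : forall w x, m (xperm w x) = m x.

(** The weights [1] and [eta_coef] give the two algebras of the theorem, so
    that bases are found for both at once. *)
Definition coord_lattice : set E :=
  [set u | S_alg B n d u /\ forall x, nat_dvd (m x) (tens_coord u x)].

Lemma coord_lattice_submodule : is_submodule coord_lattice.
Proof.
split.
  split; last by move=> x; rewrite tens_coord0; apply: nat_dvd0.
  by apply/S_algP => w x; rewrite !tens_coord0 mulr0.
move=> c u v [/S_algP Su mu] [/S_algP Sv mv]; split=> [|x].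
  by apply/S_algP => w x; rewrite !tens_coordD !tens_coordZ Su Sv; ring.
rewrite tens_coordD tens_coordZ; apply: nat_dvdD => //.
exact: nat_dvd_mull.
Qed.

Lemma coord_lattice_sum (P : pred mi) (c : mi -> k) (v : mi -> E) :
  (forall x, P x -> coord_lattice (v x)) ->
  coord_lattice (\sum_(x | P x) c x *: v x).
Proof.
have [L0 LD] := coord_lattice_submodule => Lv.
apply: big_ind => // [u u' Lu Lu'|x Px].
  by rewrite -[u]scale1r; apply: LD.
by rewrite -[_ *: _]addr0; apply: LD => //; apply: Lv.
Qed.

Lemma coord_lattice_xi x : Tri x -> coord_lattice ((m x)%:R *: xi x).
Proof.
move=> Tx; split=> [w|y]; first by rewrite linearZ /= S_alg_xi.
rewrite tens_coordZ; have [|nxy] := boolP (in_orb x y).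
  move=> /existsP[w /eqP ->]; rewrite xi_coord // m_perm.
  by exists (perm_sign w x); rewrite mulr_natl.
by rewrite xi_coord0 // mulr0; apply: nat_dvd0.
Qed.

Lemma xi_comb_coord (c : mi -> k) y : Tri_rep y ->
  tens_coord (\sum_(x | Tri_rep x) c x *: ((m x)%:R *: xi x)) y
    = c y * (m y)%:R.
Proof.
move=> Ry; have /andP[Ty /eqP yy] := Ry.
rewrite tens_coord_sum (bigD1 y) //= !tens_coordZ.
have -> : tens_coord (xi y) y = 1.
  rewrite -{2}(xperm1 y) xi_coord //.
  by apply: perm_sign_fix => i; rewrite perm1.
rewrite mulr1 big1 ?addr0 // => x /andP[/andP[Tx /eqP xx] ne].
rewrite !tens_coordZ xi_coord0 ?mulr0 //; apply: contraNN ne => xy.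
by rewrite -xx -yy (orb_rep_eq xy).
Qed.

Lemma coord_lattice_comb u : coord_lattice u -> exists c : mi -> k,
  u = \sum_(x | Tri_rep x) c x *: ((m x)%:R *: xi x).
Proof.
move=> [Su /fin_all_exists[c cE]]; exists c; apply: S_alg_ext => // [|x Rx].
  apply: (proj1 (coord_lattice_sum _ _)) => x /andP[Tx _].
  exact: coord_lattice_xi.
by rewrite xi_comb_coord // cE mulr_natr.
Qed.

Lemma coord_lattice_basis :
  is_basis Tri_rep (fun x => (m x)%:R *: xi x : E) coord_lattice.
Proof.
split=> [|c c0 y Ry].
  apply/seteqP; split=> [u /coord_lattice_comb[c ->]|_ [c _ <-]];
    first by exists c.
  by apply: coord_lattice_sum => x /andP[Tx _]; apply: coord_lattice_xi.
have := xi_comb_coord c Ry; rewrite c0 tens_coord0 => /esym/eqP.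
by rewrite mulf_eq0 (negbTE (k_char0 _)) // orbF => /eqP.
Qed.

Lemma coord_latticeE : coord_lattice =
  [set \sum_(x | Tri x) c x *: ((m x)%:R *: xi x) | c in [set: mi -> k]].
Proof.
apply/seteqP; split=> [u /coord_lattice_comb[c ->]|_ [c _ <-]]; last first.
  by apply: coord_lattice_sum => x Tx; apply: coord_lattice_xi.
exists (fun x => if orb_rep x == x then c x else 0) => //.
rewrite [RHS]big_mkcondr; apply: eq_bigr => x _.
by case: ifP => // _; rewrite scale0r.
Qed.

End Lattice.

(** The group denoted [H_x] in the comments. *)
Definition deg2_young x : {group 'S_d} :=
  young_group x (fun l : mx_idx B n => hb_deg l.1.1 == 2 :> nat).

Lemma card_deg2_young x : #|deg2_young x| = eta_coef x.
Proof.
rewrite card_young /eta_coef.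
under [RHS]eq_bigr => c _ do rewrite pair_bigA.
rewrite pair_big_dep /=.
rewrite (reindex (fun q : B * ('I_n * 'I_n) => (q.1, q.2.1, q.2.2))) /=.
  by apply: eq_big => [[c [p q]]|[c [p q]] _] //=; rewrite andbT.
by exists (fun l => (l.1.1, (l.1.2, l.2))) => [[c [p q]]|[[c p] q]].
Qed.

Lemma eta_coef_gt0 x : (0 < eta_coef x)%N.
Proof. by rewrite -card_deg2_young cardG_gt0. Qed.

Lemma eta_coef_perm w x : eta_coef (xperm w x) = eta_coef x.
Proof.
apply: eq_bigr => c _; apply: eq_bigr => p _; apply: eq_bigr => q _.
congr (_`!); rewrite -!sum1_card [RHS](reindex_inj (@perm_inj _ w)) /=.
by apply: eq_bigl => i; rewrite !inE ffunE.
Qed.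

Lemma S_algE : S_alg B n d = coord_lattice (fun=> 1%N).
Proof.
by apply/seteqP; split=> [u Su|u []] //; split=> // x; exists (tens_coord u x).
Qed.

Lemma T_algE : T_alg B n d = coord_lattice (@eta_coef k A B n d).
Proof. by rewrite coord_latticeE //; apply: eta_coef_perm. Qed.

Lemma S_alg_submodule : is_submodule (S_alg B n d).
Proof. by rewrite S_algE; apply: coord_lattice_submodule. Qed.

Lemma T_alg_submodule : is_submodule (T_alg B n d).
Proof. by rewrite T_algE; apply: coord_lattice_submodule. Qed.

Lemma T_alg_sub_S : T_alg B n d `<=` S_alg B n d.
Proof. by rewrite T_algE => u []. Qed.

Lemma S_alg_has_rank : has_rank (S_alg B n d) #|Tri_rep|.
Proof.
by rewrite S_algE; apply: is_basis_has_rank (coord_lattice_basis _ _).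
Qed.

Lemma T_alg_has_rank : has_rank (T_alg B n d) #|Tri_rep|.
Proof.
rewrite T_algE; apply: is_basis_has_rank; apply: coord_lattice_basis.
  exact: eta_coef_gt0.
exact: eta_coef_perm.
Qed.

End Lattices.

(** * Closure properties and the transfer *)

Section Closure.
Variables (k : idomainType) (A : graded_algebra k) (B : homog_basis A).
Variables (n d : nat).
Hypothesis k_char0 : forall m : nat, (0 < m)%N -> m%:R != 0 :> k.
Local Notation mi := {ffun 'I_d -> mx_idx B n}.
Local Notation E := (tens B n d).
Implicit Types (u v : E) (x y z : mi) (w : 'S_d).
Implicit Types (X : 'I_d -> 'M[A]_n).

Definition deg0_entries (M : 'M[A]_n) := forall r s, ga_comp A 0 (M r s).

Lemma deg0_parity X : (forall i, deg0_entries (X i)) ->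
  pure_parity B X (fun=> false).
Proof. by move=> X0 i l nz; rewrite /mx_odd (hb_coord_deg (X0 i _ _) nz). Qed.

Lemma deg0_entries1 : deg0_entries (1%:M).
Proof.
move=> r s; rewrite mxE; case: eqP => _ /=; first exact: (ga_comp1 B).
exact: (proj1 (ga_submodule A 0)).
Qed.

Lemma perm_act_pure0 w X : (forall i, deg0_entries (X i)) ->
  perm_act w (pure_tens B X) = pure_tens B (fun i => X (w i)).
Proof.
by move=> /deg0_parity/(perm_act_pure w) ->; rewrite inv_sign_fix // scale1r.
Qed.

Lemma S_alg1 : S_alg B n d 1.
Proof.
by move=> w; rewrite tens1E perm_act_pure0 // => i; apply: deg0_entries1.
Qed.

Lemma S_algM u v : S_alg B n d u -> S_alg B n d v -> S_alg B n d (u * v).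
Proof. by move=> Su Sv w; rewrite perm_act_mul Su Sv. Qed.

Lemma deg2_young_xperm x w : w \in deg2_young x -> xperm w x = x.
Proof. by case/youngP => h _; apply/ffunP => i; rewrite ffunE h. Qed.

Lemma deg2_young_sign x w : w \in deg2_young x -> perm_sign w x = 1.
Proof.
move=> xw; have /youngP[w1 _] := xw; apply: perm_sign_fix => i; rewrite w1 => o.
by apply: (young_fix xw); apply: contraTN o => /eqP; rewrite /mx_odd => ->.
Qed.

Lemma deg2_young_coord x w u : w \in deg2_young x ->
  tens_coord (perm_act w u) x = tens_coord u x.
Proof.
move=> xw; rewrite -{1}(deg2_young_xperm xw) perm_act_coord.
by rewrite deg2_young_sign // mul1r.
Qed.

Lemma T_algP u : T_alg B n d u <->
  S_alg B n d u /\ forall x, nat_dvd (eta_coef x) (tens_coord u x).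
Proof. by rewrite (T_algE B n d k_char0). Qed.

Lemma T_alg1 : T_alg B n d 1.
Proof.
apply/T_algP; split=> [|x]; first exact: S_alg1.
rewrite tens1E tens_coord_pure.
have [->|/prodf_neq0 nz] := eqVneq (\prod_i mx_coord (x i) 1%:M : k) 0.
  exact: nat_dvd0.
rewrite -card_deg2_young; have -> : deg2_young x = 1%G; last first.
  by rewrite cards1; exists (\prod_i mx_coord (x i) 1%:M).
apply/trivGP/subsetP => w xw; rewrite inE; apply/eqP/permP => i; rewrite perm1.
by apply: (young_fix xw); rewrite (hb_coord_deg (deg0_entries1 _ _) (nz i isT)).
Qed.

Lemma tens_mul_coord u v z : tens_coord (u * v) z =
  \sum_(q : mi * mi) tens_coord u q.1 * tens_coord v q.2 *
     tens_coord (tens_vec q.1 * tens_vec q.2) z.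
Proof.
rewrite -(pair_bigA _ (fun x y => tens_coord u x * tens_coord v y *
     tens_coord (tens_vec x * tens_vec y) z)) /= tens_mul_sum tens_coord_sum.
apply: eq_bigr => x _; rewrite tens_coord_sum; apply: eq_bigr => y _.
by rewrite tens_coordZ.
Qed.

Lemma tens_vec_mul_deg x y z : tens_coord (tens_vec x * tens_vec y) z != 0 ->
  forall i, hb_deg (z i).1.1 = (hb_deg (x i).1.1 + hb_deg (y i).1.1)%N :> nat.
Proof.
rewrite tens_mul_vec tens_coordZ mulf_eq0 negb_or tens_coord_pure.
by move=> /andP[_ /prodf_neq0 nz] i; apply: mx_mul_deg; apply: nz.
Qed.

(** For fixed [z], the group [H_z] acts on the pairs [(x, y)] that contribute to
    the coordinate of [u * v] at [z]. A permutation in the stabilizer of such a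
    pair moves places where the degrees of [x] and [y] add up to 2; they are
    not both 1, because an odd entry of [x] is not repeated. So the stabilizer
    is an extension of a subgroup of [H_x] by a subgroup of [H_y], and its
    order divides the product of the two coordinates. *)
Lemma T_algM u v : T_alg B n d u -> T_alg B n d v -> T_alg B n d (u * v).
Proof.
move=> /T_algP[Su Tu] /T_algP[Sv Tv]; apply/T_algP; split=> [|z].
  exact: S_algM.
rewrite tens_mul_coord -card_deg2_young.
apply: (nat_dvd_sum_act (act := fun w (q : mi * mi) =>
  (xperm w q.1, xperm w q.2))) => [[x y]|g h [x y]|h [x y] zh|[x y]] /=.
- by rewrite !xperm1.
- by rewrite !xpermM.
- have /S_algP -> := Su; have /S_algP -> := Sv.
  rewrite -[in RHS](deg2_young_coord _ zh) perm_act_mul !perm_act_vec.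
  rewrite -kalg_scaleAl -kalg_scaleAr !tens_coordZ -!/(xperm h _); ring.
set K := finset _; set c := tens_coord (_ * _) z.
have [->|nzu] := eqVneq (tens_coord u x) 0.
  by rewrite !mul0r; apply: nat_dvd0.
have [->|nzc] := eqVneq c 0; first by rewrite mulr0; apply: nat_dvd0.
have zE := tens_vec_mul_deg nzc.
pose K' := young_group (fun i => (x i, y i, z i))
  (fun l : mx_idx B n * mx_idx B n * mx_idx B n => hb_deg l.2.1.1 == 2 :> nat).
have -> : K = K'.
  apply/setP => w; rewrite inE; apply/andP/youngP.
    move=> [/youngP[w1 w2] /eqP[wx wy]]; split=> // i.
    by rewrite w1 -[in RHS]wx -[in RHS]wy !ffunE.
  move=> [w1 w2]; split.
    by apply/youngP; split=> // i; have [] := w1 i.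
  by apply/eqP; congr (_, _); apply/ffunP => i; rewrite ffunE; have [] := w1 i.
have [a ua] := Tu x; have [b vb] := Tv y.
apply: (@nat_dvd_trans _ _ (eta_coef x * eta_coef y)); last first.
  exists (a * b * c); rewrite ua vb mulrnA.
  by rewrite mulrnAl mulrnAr !mulrnAl -!mulrnA mulnC.
rewrite -!card_deg2_young.
pose D := [set i | hb_deg (x i).1.1 == 2 :> nat]%SET.
have K'x w i : w \in K' -> x (w i) = x i.
  by case/youngP => w1 _; have [] := w1 i.
have K'N w : w \in K' -> w \in 'N(D | 'P).
  by move=> Kw; apply/astabsP => i; rewrite !inE /= apermE (K'x _ _ Kw).
apply: (dvdn_card_restr (D := D)) => [|w Kw|w Kw rw].
- by apply/subsetP => w; apply: K'N.
- apply/youngP; split=> i.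
    have [Di|nDi] := boolP (i \in D); first by rewrite restr_permE ?K'N ?K'x.
    by rewrite (out_perm (restr_perm_on D w)).
  by apply: contraR => nDi; rewrite (out_perm (restr_perm_on D w)) ?inE.
have /youngP[w1 w2] := Kw; apply/youngP; split=> i; first by have [] := w1 i.
move=> ne; have := w2 i ne; rewrite /= zE => /eqP deg_xy.
have nDi : i \notin D.
  by apply: contra ne => Di; rewrite -(restr_permE (K'N _ Kw) Di) rw perm1.
have even_x : ~~ mx_odd (x i).
  have /forallP/(_ i)/forallP/(_ (w i)) := S_alg_Tri k_char0 Su nzu.
  by rewrite K'x // eqxx andbT eq_sym ne.
move: nDi even_x deg_xy; rewrite !inE /mx_odd.
case: (hb_deg (x i).1.1) => [[|[|[|]]] //= _] _ _.
by rewrite add0n => ->.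
Qed.

Lemma S_alg_is_subalgebra : is_subalgebra (S_alg B n d).
Proof.
split; [exact: S_alg_submodule|exact: S_alg1|exact: S_algM|].
by exists #|@Tri_rep k A B n d|; apply: S_alg_has_rank.
Qed.

Lemma T_alg_is_subalgebra : is_subalgebra (T_alg B n d).
Proof.
split; [exact: T_alg_submodule|exact: T_alg1|exact: T_algM|].
by exists #|@Tri_rep k A B n d|; apply: T_alg_has_rank.
Qed.

Definition transfer u : E := \sum_(w : 'S_d) perm_act w u.

Lemma transfer_linear : linear transfer.
Proof.
move=> c u v; rewrite /transfer scaler_sumr -big_split.
by apply: eq_bigr => w _; rewrite linearP.
Qed.

HB.instance Definition _ :=
  GRing.isLinear.Build k E E *:%R transfer transfer_linear.

Lemma transfer_perm w u : transfer (perm_act w u) = transfer u.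
Proof.
rewrite /transfer [RHS](reindex_inj (mulIg w)).
by apply: eq_bigr => v _; rewrite perm_actM.
Qed.

Lemma transfer_S u : S_alg B n d u -> transfer u = u *+ d`!.
Proof.
move=> Su; rewrite /transfer (eq_bigr (fun=> u)) => [|w _]; last by rewrite Su.
by rewrite sumr_const card_Sn.
Qed.

Lemma S_alg_transfer u : S_alg B n d (transfer u).
Proof.
move=> w; rewrite linear_sum [RHS](reindex_inj (mulgI w)).
by apply: eq_bigr => v _; rewrite perm_actM.
Qed.

(** [H_x] acts freely on the terms of the coordinate at [x], by left
    translation. *)
Lemma T_alg_transfer u : T_alg B n d (transfer u).
Proof.
apply/T_algP; split=> [|x]; first exact: S_alg_transfer.
rewrite tens_coord_sum -card_deg2_young.
apply: (nat_dvd_sum_act (X := 'S_d) (act := fun v w : 'S_d => (v * w)%g)) =>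
  [w|v v' w|v w xv|w].
- exact: mul1g.
- by rewrite mulgA.
- by rewrite perm_actM deg2_young_coord.
exists (tens_coord (perm_act w u) x); rewrite -[LHS]mulr1n; congr (_ *+ _).
rewrite -(cards1 (1%g : 'S_d)); apply: eq_card => v; rewrite in_set1 in_set.
apply/eqP/andP => [->|[_ /eqP e]]; first by rewrite group1 mul1g.
by apply: (mulIg w); rewrite mul1g.
Qed.

End Closure.

(** * The trace form *)

Section TraceForm.
Variables (k : idomainType) (A : graded_algebra k) (t : A -> k).
Hypothesis t_sym : symmetrizing_form [set: A] t.
Hypothesis t_deg : degree_m2 t.
Variable B : homog_basis A.

Lemma t_linear : linear (t : A -> k^o).
Proof. by have [tL _ _] := t_sym => c x y; apply: tL. Qed.

HB.instance Definition _ := GRing.isLinear.Build k A k^o *:%R t t_linear.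

Lemma t_mulC x y : t (x * y) = t (y * x).
Proof. by have [_ tC _] := t_sym; apply: tC. Qed.

Lemma t_comp0 i x : i != 2 -> ga_comp A i x -> t x = 0.
Proof.
have z j : ga_comp A j 0 := proj1 (ga_submodule A j).
case: i => [|[|[|i]]] // _ Ax.
- by rewrite -[x]addr0; apply: t_deg.
- by rewrite -[x]add0r; apply: t_deg.
- by move: Ax; rewrite ga_comp_gt2 // => ->; apply: (linear0 t).
Qed.

(** The dual of [b] may be replaced by its component of degree [2 - deg b],
    because [t] vanishes outside degree 2. *)
Lemma hb_dual_exists (b : B) : exists a : A,
  (forall y, t (a * y) = hb_coord b y)
  /\ (forall b' : B, hb_coord b' a != 0 -> (hb_deg b' + hb_deg b)%N = 2).
Proof.
have [_ _ /(_ (hb_coord b)) t_dual] := t_sym.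
have [|a [[_ aE] _]] := t_dual; first by move=> c x y _ _; apply: linearP.
have t_vec (b1 b2 : B) :
    (hb_deg b1 + hb_deg b2)%N != 2 -> t (hb_vec b1 * hb_vec b2) = 0.
  by move=> ne; apply: (t_comp0 ne); apply: ga_mul; apply: hb_vec_comp.
pose c (b' : B) : k :=
  if (hb_deg b' + hb_deg b)%N == 2 then hb_coord b' a else 0.
exists (\sum_b' c b' *: hb_vec b'); split=> [y|b']; last first.
  by rewrite hb_coordE /c; case: ifP => [/eqP //|_ /eqP].
have t_sumE (c1 : B -> k) (b2 : B) :
    t ((\sum_b1 c1 b1 *: hb_vec b1) * hb_vec b2) =
    \sum_b1 c1 b1 * t (hb_vec b1 * hb_vec b2).
  rewrite big_distrl linear_sum; apply: eq_bigr => b1 _ /=.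
  by rewrite -kalg_scaleAl linearZ.
rewrite -[in RHS](hb_coordK B y) -{1}(hb_coordK B y) big_distrr !linear_sum /=.
apply: eq_bigr => b2 _; rewrite -kalg_scaleAr !linearZ /=; congr (_ * _).
rewrite -[RHS]aE // -(hb_coordK B a) !t_sumE.
have [e|ne] := eqVneq (hb_deg b2) (hb_deg b).
  apply: eq_bigr => b1 _; rewrite /c; case: ifP => // /negbT ne.
  by rewrite t_vec ?mulr0 // e.
rewrite -[RHS]t_sumE (hb_coordK B) aE // hb_coord_vec.
case: (eqVneq b2 b) => [e|_]; first by rewrite e eqxx in ne.
apply: big1 => b1 _; rewrite /c; case: ifP => [/eqP e|_]; last by rewrite mul0r.
rewrite t_vec ?mulr0 // -e eqn_add2l.
by apply: contra ne => /eqP/val_inj ->.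
Qed.

Lemma dual_basis_exists : exists D : B -> A,
  (forall (b : B) (a : A), t (D b * a) = hb_coord b a)
  /\ (forall b b' : B, hb_coord b' (D b) != 0 -> (hb_deg b' + hb_deg b)%N = 2).
Proof.
have [D DE] := fin_all_exists hb_dual_exists.
by exists D; split=> b; have [] := DE b.
Qed.

Variable D : B -> A.
Hypothesis D_dual : forall b y, t (D b * y) = hb_coord b y.
Hypothesis D_deg :
  forall b b' : B, hb_coord b' (D b) != 0 -> (hb_deg b' + hb_deg b)%N = 2.

Variables (n d : nat).
Hypothesis k_char0 : forall m : nat, (0 < m)%N -> m%:R != 0 :> k.
Local Notation mi := {ffun 'I_d -> mx_idx B n}.
Local Notation E := (tens B n d).
Implicit Types (u v : E) (x y z : mi) (w : 'S_d) (l m : mx_idx B n).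
Implicit Types (X : 'I_d -> 'M[A]_n) (M N : 'M[A]_n).

Definition mx_form M : k := \sum_p t (M p p).

Lemma mx_formC M N : mx_form (M *m N) = mx_form (N *m M).
Proof.
rewrite /mx_form; under eq_bigr => p _ do rewrite mxE linear_sum.
rewrite exchange_big; apply: eq_bigr => p _ /=; rewrite mxE linear_sum.
by apply: eq_bigr => q _; apply: t_mulC.
Qed.

Lemma mx_form_comp0 i M : i != 2 -> (forall r s, ga_comp A i (M r s)) ->
  mx_form M = 0.
Proof. by move=> ne Mi; apply: big1 => p _; apply: t_comp0 (Mi p p). Qed.

Lemma mx_form_expand M :
  mx_form M = \sum_(l : mx_idx B n) mx_coord l M * mx_form (mx_vec l).
Proof.
rewrite -{1}(mx_coordK B M) /mx_form.
under eq_bigr => p _ do rewrite summxE linear_sum.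
rewrite exchange_big; apply: eq_bigr => l _; rewrite mulr_sumr.
by apply: eq_bigr => p _; rewrite /= mxE linearZ.
Qed.

Definition mx_dual l : 'M[A]_n := mx_elt (D l.1.1) l.2 l.1.2.

Lemma mx_form_dual l M : mx_form (mx_dual l *m M) = mx_coord l M.
Proof.
case: l => [[b r] s]; rewrite /mx_form /mx_coord /= -D_dual (bigD1 s) //=.
rewrite mxE (bigD1 r) //= !mxE !eqxx /= !big1 ?addr0 // => [p ne|p ne].
  rewrite mxE big1 ?linear0 // => q _.
  by rewrite !mxE /= (negbTE ne) mul0r.
by rewrite mxE /= (negbTE ne) andbF mul0r.
Qed.

Lemma mx_dual_deg l m :
  mx_coord m (mx_dual l) != 0 -> (hb_deg m.1.1 + hb_deg l.1.1)%N = 2.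
Proof.
rewrite /mx_coord mxE; case: ifP => _; last by rewrite linear0 eqxx.
exact: D_deg.
Qed.

Lemma mx_dual_odd l m : mx_coord m (mx_dual l) != 0 -> mx_odd m = mx_odd l.
Proof.
move=> /mx_dual_deg/(congr1 odd); rewrite oddD /mx_odd.
by case: (odd _) (odd _) => [] [].
Qed.

Lemma mx_form_vec_deg l : mx_form (mx_vec l) != 0 -> hb_deg l.1.1 = 2 :> nat.
Proof.
move=> nz; apply/eqP; apply: contraNT nz => ne; apply/eqP.
apply: (mx_form_comp0 ne) => r s; rewrite mxE; case: ifP => _.
  exact: hb_vec_comp.
exact: (proj1 (ga_submodule A _)).
Qed.

Lemma mx_form_mul_odd l m :
  mx_form (mx_vec l *m mx_vec m) != 0 -> mx_odd l = mx_odd m.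
Proof.
move=> nz; have /(congr1 odd) : (hb_deg l.1.1 + hb_deg m.1.1)%N = 2.
  apply/eqP; apply: contraNT nz => ne; apply/eqP.
  by apply: (mx_form_comp0 ne) => r s; apply: mx_mul_comp.
by rewrite oddD /mx_odd; case: (odd _) (odd _) => [] [].
Qed.

(** The tensor power of [mx_form]. *)
Definition tens_form u : k :=
  \sum_x tens_coord u x * \prod_i mx_form (mx_vec (x i)).

Lemma tens_form_linear : linear (tens_form : E -> k^o).
Proof.
move=> c u v; rewrite /tens_form scaler_sumr -big_split; apply: eq_bigr => x _.
by rewrite tens_coordD tens_coordZ mulrDl -mulrA.
Qed.

HB.instance Definition _ :=
  GRing.isLinear.Build k E k^o *:%R tens_form tens_form_linear.

Lemma tens_formZ c u : tens_form (c *: u) = c * tens_form u.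
Proof. exact: linearZ. Qed.

Lemma tens_formD u v : tens_form (u + v) = tens_form u + tens_form v.
Proof. exact: (linearD tens_form). Qed.

Lemma tens_formB u v : tens_form (u - v) = tens_form u - tens_form v.
Proof. exact: (linearB tens_form). Qed.

Lemma tens_form_pure X : tens_form (pure_tens B X) = \prod_i mx_form (X i).
Proof.
under [RHS]eq_bigr => i _ do rewrite mx_form_expand.
rewrite bigA_distr_bigA; apply: eq_bigr => x _.
by rewrite tens_coord_pure big_split.
Qed.

(** Both orders carry the same sign: a term is nonzero only if the two factors
    have the same parity at each place. *)
Lemma tens_form_mulC u v : tens_form (u * v) = tens_form (v * u).
Proof.
rewrite !tens_mul_sum !linear_sum /=.
under eq_bigr => x _ do rewrite linear_sum.
under [RHS]eq_bigr => x _ do rewrite linear_sum.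
rewrite [RHS]exchange_big; apply: eq_bigr => x _; apply: eq_bigr => y _ /=.
rewrite !tens_formZ [tens_coord v y * _]mulrC; congr (_ * _).
rewrite !tens_mul_vec !tens_formZ !tens_form_pure.
under [in RHS]eq_bigr => i _ do rewrite mx_formC.
have [->|/prodf_neq0 nz] :=
  eqVneq (\prod_i mx_form (mx_vec (x i) *m mx_vec (y i))) 0.
  by rewrite !mulr0.
have odd_xy i : mx_odd (x i) = mx_odd (y i).
  by apply: mx_form_mul_odd; apply: nz.
by congr (_ * _); apply: (@eq_cross_sign k d) => i.
Qed.

Lemma tens_form_perm w u : tens_form (perm_act w u) = tens_form u.
Proof.
rewrite -[in RHS](tens_coordK u) /perm_act !linear_sum.
apply: eq_bigr => x _ /=.
rewrite !tens_formZ -mulrA; congr (_ * _); rewrite !tens_form_pure.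
have <- : \prod_i mx_form (mx_vec (x i)) =
    \prod_i mx_form (mx_vec ([ffun i => x (w i)] i)).
  rewrite [LHS](reindex_inj (@perm_inj _ w)).
  by apply: eq_bigr => i _; rewrite ffunE.
have [->|/prodf_neq0 nz] := eqVneq (\prod_i mx_form (mx_vec (x i))) 0.
  by rewrite mulr0.
rewrite perm_sign_fix ?mul1r // => i.
by rewrite /mx_odd (mx_form_vec_deg (nz _ isT)).
Qed.

(** The sign compensates for the one in the product with [tens_vec y]. *)
Definition tens_dual y : E :=
  cross_sign k (fun i => mx_odd (y i)) (fun i => mx_odd (y i))
    *: pure_tens B (fun i => mx_dual (y i)).

Lemma mx_dual_parity y :
  pure_parity B (fun i => mx_dual (y i)) (fun i => mx_odd (y i)).
Proof. by move=> i l; apply: mx_dual_odd. Qed.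
Arguments mx_dual_parity : clear implicits.

Lemma tens_form_dual y u : tens_form (tens_dual y * u) = tens_coord u y.
Proof.
rewrite -{1}(tens_coordK u) mulr_sumr linear_sum /=.
rewrite (bigD1 y) //= [X in _ + X]big1 => [|x ne].
  rewrite addr0 -kalg_scaleAr -kalg_scaleAl !tens_formZ.
  rewrite (pure_tensM (mx_dual_parity y) (mx_vec_parity y)) tens_formZ.
  rewrite tens_form_pure big1 => [|i _];
    last by rewrite mx_form_dual mx_coord_vecE eqxx.
  by rewrite mulr1 cross_sign_sqr mulr1.
rewrite -kalg_scaleAr -kalg_scaleAl !tens_formZ.
rewrite (pure_tensM (mx_dual_parity y) (mx_vec_parity x)) tens_formZ.
rewrite tens_form_pure.
under eq_bigr => i _ do rewrite mx_form_dual.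
by rewrite -tens_coord_pure tens_coord_vec (negbTE ne) !mulr0.
Qed.

Lemma tens_form_nondeg u : (forall v, tens_form (u * v) = 0) -> u = 0.
Proof.
move=> u0; apply: tens_coord_inj => x.
by rewrite tens_coord0 -tens_form_dual tens_form_mulC u0.
Qed.

Lemma tens_dual_perm_deg w x y :
  tens_coord (perm_act w (tens_dual y)) x != 0 ->
  forall i, (hb_deg (x i).1.1 + hb_deg (y (w i)).1.1)%N = 2.
Proof.
rewrite linearZ /= (perm_act_pure _ (mx_dual_parity y)) !tens_coordZ.
rewrite !mulf_eq0 !negb_or tens_coord_pure => /and3P[_ _ /prodf_neq0 nz] i.
by apply: mx_dual_deg; apply: nz.
Qed.

Lemma deg2_young_dual w y : w \in deg2_young y ->
  perm_act w (tens_dual y) = tens_dual y.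
Proof.
move=> yw; rewrite linearZ /= (perm_act_pure _ (mx_dual_parity y)).
rewrite -perm_signE deg2_young_sign // scale1r; congr (_ *: _).
apply: eq_pure_tens => i; congr mx_dual.
by rewrite -[in RHS](deg2_young_xperm yw) ffunE.
Qed.

Lemma tens_form_transfer u v : S_alg B n d v ->
  tens_form (transfer u * v) = tens_form (u * v) *+ d`!.
Proof.
move=> Sv; rewrite /transfer mulr_suml linear_sum /=.
rewrite (eq_bigr (fun=> tens_form (u * v))) => [|w _]; last first.
  by rewrite -[in LHS](Sv w) -perm_act_mul tens_form_perm.
by rewrite sumr_const card_Sn.
Qed.

Lemma S_alg_nondeg u : S_alg B n d u ->
  (forall v, T_alg B n d v -> tens_form (u * v) = 0) -> u = 0.
Proof.
move=> Su u0; apply: tens_form_nondeg => v; rewrite tens_form_mulC.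
have := u0 _ (T_alg_transfer k_char0 v).
rewrite tens_form_mulC tens_form_transfer // -mulr_natr => /eqP.
by rewrite mulf_eq0 (negbTE (k_char0 (fact_gt0 d))) orbF => /eqP.
Qed.

(** Only indices of degree 2 at every place contribute, and the stabilizer of
    such an index [x] in the symmetric group is [H_x]. *)
Lemma T_alg_form_dvd u : T_alg B n d u -> nat_dvd d`! (tens_form u).
Proof.
move=> /(T_algP k_char0)[/S_algP Su Tu]; rewrite -card_Sn -cardsT.
apply: (nat_dvd_sum_act (G := [group of [set: 'S_d]]) (X := mi)
  (act := @xperm d (mx_idx B n))) => [x|v w x|w x _|x].
- exact: xperm1.
- exact: xpermM.
- rewrite Su.
  have -> : \prod_i mx_form (mx_vec (xperm w x i)) =
      \prod_i mx_form (mx_vec (x i)).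
    rewrite [RHS](reindex_inj (@perm_inj _ w)).
    by apply: eq_bigr => i _; rewrite ffunE.
  have [->|/prodf_neq0 nz] := eqVneq (\prod_i mx_form (mx_vec (x i))) 0.
    by rewrite !mulr0.
  rewrite perm_sign_fix ?mul1r // => i.
  by rewrite /mx_odd (mx_form_vec_deg (nz _ isT)).
have [->|/prodf_neq0 nz] := eqVneq (\prod_i mx_form (mx_vec (x i))) 0.
  by rewrite mulr0; apply: nat_dvd0.
rewrite mulrC; apply: nat_dvd_mull; have := Tu x; rewrite -card_deg2_young.
congr (nat_dvd _ _); apply: eq_card => w; rewrite [RHS]in_set /= in_setT /=.
apply/youngP/eqP => [[w1 _]|wx]; first by apply/ffunP => i; rewrite ffunE w1.
split=> i; first by rewrite -[in RHS]wx ffunE.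
by rewrite (mx_form_vec_deg (nz _ isT)).
Qed.

Lemma S_alg_scale_T u (m : nat) : (0 < m)%N -> S_alg B n d u ->
  (forall x, nat_dvd (eta_coef x * m) (tens_coord u x)) ->
  exists2 v, T_alg B n d v & u = m%:R *: v.
Proof.
move=> m0 /S_algP Su /fin_all_exists[c cE].
have mI (a b : k) : m%:R * a = m%:R * b -> a = b by apply/mulfI/k_char0.
pose v : E := \sum_x (c x *+ eta_coef x) *: tens_vec x.
have vE x : tens_coord v x = c x *+ eta_coef x.
  rewrite tens_coord_sum (bigD1 x) //= tens_coordZ tens_coord_vec eqxx mulr1.
  rewrite big1 ?addr0 // => y ne.
  by rewrite tens_coordZ tens_coord_vec (negbTE ne) mulr0.
have uE x : tens_coord u x = m%:R * tens_coord v x.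
  by rewrite cE vE mulr_natl mulrnA.
exists v; last by apply: tens_coord_inj => x; rewrite tens_coordZ uE.
apply/(T_algP k_char0); split=> [|x]; last by rewrite vE; exists (c x).
by apply/S_algP => w x; apply: mI; rewrite -uE Su uE; ring.
Qed.

(** [H_x * H_y] acts on permutations from both sides, and the terms are
    invariant. The action is free on the nonzero terms: there the degrees of
    [x] at [i] and of [y] at [w i] add up to 2, so [w] takes no place moved by
    [H_x] to a place moved by [H_y]. *)
Lemma transfer_dual_dvd x y :
  nat_dvd (eta_coef x * eta_coef y) (tens_coord (transfer (tens_dual y)) x).
Proof.
rewrite tens_coord_sum -!card_deg2_young -cardsX.
apply: (nat_dvd_sum_act (G := [group of setX (deg2_young x) (deg2_young y)])
  (X := 'S_d) (act := fun h w => (h.1 * w * h.2^-1)%g))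
  => [w|g h w|[g h] w /setXP[xg yh]|w] /=.
- by rewrite mul1g invg1 mulg1.
- by rewrite invMg !mulgA.
- rewrite !perm_actM deg2_young_coord //; congr tens_coord; congr perm_act.
  by apply: (can_inj (perm_actK h));
    rewrite -perm_actM mulgV perm_act1 deg2_young_dual.
have [->|nz] := eqVneq (tens_coord (perm_act w (tens_dual y)) x) 0.
  exact: nat_dvd0.
exists (tens_coord (perm_act w (tens_dual y)) x).
rewrite -[LHS]mulr1n; congr (_ *+ _).
transitivity #|[set (1%g : 'S_d * 'S_d)]%SET|; first by rewrite cards1.
apply: eq_card => -[g h].
rewrite in_set1 in_set; apply/eqP/andP => [[-> ->]|]; last first.
  move=> [/setXP[xg yh] /= /eqP e].
  have {}e : (g * w = w * h)%g by rewrite -{2}e mulgKV.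
  have g1 : g = 1%g.
    apply/permP => i; rewrite perm1; apply/eqP; apply: contraT => ne.
    have /youngP[_ /(_ i ne)/eqP xi2] := xg.
    have hne : h (w i) != w i.
      by rewrite -permM -e permM (inj_eq perm_inj).
    have /youngP[_ /(_ _ hne)/eqP yi2] := yh.
    by have := tens_dual_perm_deg nz i; rewrite xi2 yi2.
  by rewrite g1 mul1g -{1}[w]mulg1 in e; rewrite g1 -(mulgI _ _ _ e).
by rewrite group1 /= mul1g invg1 mulg1.
Qed.

(** The representative of the linear form [f (transfer u)] on all tensors also
    represents [d! f] on [T_alg]. *)
Lemma T_alg_unimodular (f : E -> k) : linear_on (T_alg B n d) f ->
  exists2 z, T_alg B n d z &
    forall v, T_alg B n d v -> tens_form (z * v) = f v *+ d`!.
Proof.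
move=> fL; pose g (u : E) : k^o := f (transfer u).
have TN u := T_alg_transfer k_char0 u.
have fZ := linear_onZ (T_alg_submodule B n d k_char0) fL.
have g_linear : linear g.
  by move=> c u v; rewrite /g linearP fL //; apply: TN.
pose gL := GRing.isLinear.Build k E k^o *:%R g g_linear.
pose gl : {linear E -> k^o} := HB.pack g gL.
pose z : E := \sum_x g (tens_vec x) *: tens_dual x.
have zE u : tens_form (z * u) = g u.
  transitivity (gl (\sum_x tens_coord u x *: tens_vec x));
    last by rewrite tens_coordK.
  rewrite /z mulr_suml !linear_sum; apply: eq_bigr => x _.
  rewrite [RHS]linearZ /= -kalg_scaleAl tens_formZ tens_form_dual.
  by rewrite /GRing.scale /= mulrC.
have Sz : S_alg B n d z.
  move=> w; apply/eqP; rewrite -subr_eq0; apply/eqP.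
  apply: tens_form_nondeg => v.
  rewrite mulrBl tens_formB -(tens_form_perm w^-1) perm_act_mul perm_actK !zE.
  by rewrite /g transfer_perm subrr.
exists z => [|v Tv]; last first.
  have /(T_algP k_char0)[Sv _] := Tv.
  by rewrite zE /g transfer_S // -scaler_nat fZ // mulr_natl.
apply/(T_algP k_char0); split=> // y.
have <- : g (tens_dual y) = tens_coord z y.
  by rewrite -zE tens_form_mulC tens_form_dual.
have [|||v Tv Nv] := @S_alg_scale_T (transfer (tens_dual y)) (eta_coef y).
- exact: eta_coef_gt0.
- exact: S_alg_transfer.
- by move=> x; apply: transfer_dual_dvd.
by exists (f v); rewrite /g Nv fZ // mulr_natl.
Qed.

End TraceForm.

(** * Integral elements and matrix units *)

Section Integrality.
Variables (k : idomainType) (E : kalgebra k) (m : nat) (e : 'I_m -> E).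
Hypothesis e_span : forall x : E, exists c : 'I_m -> k, x = \sum_i c i *: e i.

(** Cayley-Hamilton for the multiplication by [y]. *)
Lemma kalg_integral (y : E) : exists2 p : {poly k}, p \is monic &
  \sum_(i < size p) p`_i *: y ^+ i = 0.
Proof.
case: m e e_span => [e0 span0|m' e' span'].
  exists 1; first exact: monic1.
  have one0 (x : E) : x = 0 by have [c ->] := span0 x; rewrite big_ord0.
  exact: one0.
have [c cE] := fin_all_exists (fun j => span' (y * e' j)).
pose M : 'M[k]_m'.+1 := \matrix_(j, l) c j l.
have yX i j : y ^+ i * e' j = \sum_l (M ^+ i) j l *: e' l.
  elim: i j => [|i IHi] j.
    rewrite expr0 mul1r (bigD1 j) //= mxE eqxx scale1r big1 ?addr0 // => l ne.
    by rewrite mxE eq_sym (negbTE ne) scale0r.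
  rewrite exprSr -mulrA cE mulr_sumr.
  transitivity (\sum_l \sum_q (c j l * (M ^+ i) l q) *: e' q).
    apply: eq_bigr => l _; rewrite -kalg_scaleAr IHi scaler_sumr.
    by apply: eq_bigr => q _; rewrite scalerA.
  rewrite exchange_big; apply: eq_bigr => q _ /=; rewrite exprS mxE scaler_suml.
  by apply: eq_bigr => l _; rewrite mxE.
exists (char_poly M); first exact: char_poly_monic.
set p := char_poly M; set s := \sum_i _.
have se j : s * e' j = 0.
  transitivity (\sum_l (horner_mx M p) j l *: e' l); last first.
    by rewrite Cayley_Hamilton big1 // => l _; rewrite mxE scale0r.
  have -> : horner_mx M p = \sum_(i < size p) p`_i *: M ^+ i.
    rewrite -{1}(coefK p) poly_def rmorph_sum; apply: eq_bigr => i _.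
    by rewrite /= horner_mxZ rmorphXn /= horner_mx_X.
  rewrite /s mulr_suml.
  under [RHS]eq_bigr => l _ do rewrite summxE scaler_suml.
  rewrite exchange_big; apply: eq_bigr => i _ /=.
  rewrite -kalg_scaleAl yX scaler_sumr.
  by apply: eq_bigr => l _; rewrite mxE scalerA.
have [c1 one1] := span' 1; rewrite -[s]mulr1 one1 mulr_sumr big1 // => l _.
by rewrite -kalg_scaleAr se scaler0.
Qed.

(** Multiply an integral equation of degree [r] of [y] by [z ^+ (r - 1)]. *)
Lemma subalgebra_inv (T : set E) (z y : E) :
  is_subalgebra T -> T z -> z * y = 1 -> T y.
Proof.
move=> [[T0 TD] T1 TM _] Tz zy1.
have zyX i : z ^+ i * y ^+ i = 1.
  elim: i => [|i IHi]; first by rewrite mulr1.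
  by rewrite exprSr exprS mulrA -(mulrA _ z) zy1 mulr1.
have TX i : T (z ^+ i) by elim: i => [//|i IHi]; rewrite exprS; apply: TM.
have TS (I : finType) (c : I -> k) (v : I -> E) :
    (forall i, T (v i)) -> T (\sum_i c i *: v i).
  move=> Tv; apply: big_ind => // [u u' Tu Tu'|i _].
    by rewrite -[u]scale1r; apply: TD.
  by rewrite -[_ *: _]addr0; apply: TD.
have [p p_monic] := kalg_integral y.
have := monicP p_monic; rewrite lead_coefE.
have := monic_neq0 p_monic; rewrite -size_poly_gt0.
case: (size p) => [//|[|r]] _ /= p1.
  rewrite big_ord1 p1 scale1r expr0 => one0.
  by rewrite -[y]mul1r one0 mul0r.
rewrite big_ord_recr /= p1 scale1r => /eqP; rewrite addrC addr_eq0 => /eqP yE.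
have -> : y = \sum_(i < r.+1) (- p`_i) *: z ^+ (r - i).
  rewrite -[LHS]mul1r -(zyX r) -mulrA -exprSr yE mulrN mulr_sumr -sumrN.
  apply: eq_bigr => i _; rewrite scaleNr -kalg_scaleAr; congr (- (_ *: _)).
  have ir : (i <= r)%N by rewrite -ltnS.
  by rewrite -{1}(subnK ir) exprD -mulrA zyX mulr1.
by apply: TS.
Qed.

End Integrality.

Section MatrixUnits.
Variables (k : idomainType) (A : graded_algebra k) (B : homog_basis A).
Variables (n d : nat).
Local Notation ri := {ffun 'I_d -> 'I_n}.
Local Notation E := (tens B n d).
Implicit Types (r s q : ri) (w : 'S_d).

Definition tens_unit r s : E :=
  pure_tens B (fun i => mx_elt (1 : A) (r i) (s i)).

Lemma deg0_entries_elt (p q : 'I_n) : deg0_entries (mx_elt (1 : A) p q).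
Proof.
move=> p' q'; rewrite mxE; case: ifP => _; first exact: (ga_comp1 B).
exact: (proj1 (ga_submodule A 0)).
Qed.

Lemma mx_elt1M (p q p' q' : 'I_n) :
  mx_elt (1 : A) p q *m mx_elt 1 p' q' = if q == p' then mx_elt 1 p q' else 0.
Proof.
apply/matrixP => i j; rewrite mxE (bigD1 q) //= !mxE eqxx andbT.
rewrite big1 ?addr0 => [|l ne]; last by rewrite !mxE (negbTE ne) andbF mul0r.
case: (q == p') => /=; last by rewrite mulr0 mxE.
by rewrite mxE; case: (i == p) => /=; rewrite ?mul1r ?mul0r.
Qed.

Lemma tens_unitM r s s' q :
  tens_unit r s * tens_unit s' q = if s == s' then tens_unit r q else 0.
Proof.
have par r' s'' :
    pure_parity B (fun i => mx_elt (1 : A) (r' i) (s'' i)) (fun=> false).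
  by apply: deg0_parity => i; apply: deg0_entries_elt.
rewrite (pure_tensM (par r s) (par s' q)) cross_sign0 scale1r.
have [<-|] := eqVneq s s'.
  by apply: eq_pure_tens => i; rewrite mx_elt1M eqxx.
move=> ne; have [i nei] : exists i, s i != s' i.
  apply/existsP; apply: contraR ne => /existsPn h; apply/eqP/ffunP => i.
  by apply/eqP; move: (h i); rewrite negbK.
apply: tens_coord_inj => x; rewrite tens_coord_pure tens_coord0 (bigD1 i) //=.
by rewrite mx_elt1M (negbTE nei) /mx_coord mxE linear0 mul0r.
Qed.

Lemma perm_act_unit w r s :
  perm_act w (tens_unit r s) = tens_unit (xperm w r) (xperm w s).
Proof.
rewrite perm_act_pure0 => [|i]; last exact: deg0_entries_elt.
by apply: eq_pure_tens => i; rewrite !ffunE.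
Qed.

Lemma sum_tens_unit : \sum_r tens_unit r r = 1.
Proof.
apply: tens_coord_inj => x; rewrite tens1E tens_coord_sum tens_coord_pure.
have -> : 1%:M = \sum_p mx_elt (1 : A) p p :> 'M[A]_n.
  apply/matrixP => p q; rewrite summxE mxE (bigD1 p) //= mxE eqxx /= eq_sym.
  rewrite big1 ?addr0 => [|l ne]; first by case: eqP.
  by rewrite mxE eq_sym (negbTE ne).
under [RHS]eq_bigr => i _ do rewrite mx_coord_sum.
by rewrite bigA_distr_bigA; apply: eq_bigr => r _; rewrite tens_coord_pure.
Qed.

Variable omega : ri.
Hypothesis omega_inj : injective omega.

Lemma xperm_omega_inj : injective (fun w => xperm w omega).
Proof.
move=> v w e; apply/permP => i; apply: omega_inj.
by have := congr1 (fun f : ri => f i) e; rewrite !ffunE.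
Qed.

Definition row_sum r : E := transfer (tens_unit r omega).

(** The places of [omega] are distinct, so only the identity permutation
    contributes. *)
Lemma row_sum_unit r s : row_sum r * tens_unit omega s = tens_unit r s.
Proof.
rewrite /row_sum /transfer mulr_suml (bigD1 1%g) //= perm_act1 tens_unitM eqxx.
rewrite big1 ?addr0 // => v ne; rewrite perm_act_unit tens_unitM.
by rewrite -[X in _ == X]xperm1 (inj_eq xperm_omega_inj) (negbTE ne).
Qed.

End MatrixUnits.

(** * Symmetry and maximality *)

Section Maximality.
Variables (k : idomainType) (A : graded_algebra k) (t : A -> k).
Hypothesis t_sym : symmetrizing_form [set: A] t.
Hypothesis t_deg : degree_m2 t.
Variable B : homog_basis A.
Variables (n d : nat).
Hypothesis k_char0 : forall m : nat, (0 < m)%N -> m%:R != 0 :> k.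
Local Notation E := (tens B n d).
Local Notation T := (T_alg B n d).
Local Notation S := (S_alg B n d).
Local Notation form := (@tens_form k A t B n d).
Implicit Types u v : E.

Let mulfactI (a b : k) : a *+ d`! = b *+ d`! -> a = b.
Proof.
rewrite -[LHS]mulr_natr -[RHS]mulr_natr; apply: mulIf.
by apply: k_char0; apply: fact_gt0.
Qed.

Let unimodular (f : E -> k) : linear_on T f -> exists2 z, T z &
  forall v, T v -> form (z * v) = f v *+ d`!.
Proof.
have [D [D1 D2]] := dual_basis_exists t_sym t_deg B.
exact: (T_alg_unimodular t_sym t_deg D1 D2 k_char0).
Qed.

Let TS u : T u -> S u. Proof. exact: T_alg_sub_S. Qed.

Let S_eq u v : S u -> S v ->
  (forall x, T x -> form (u * x) = form (v * x)) -> u = v.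
Proof.
move=> Su Sv uv; have [D [D1 D2]] := dual_basis_exists t_sym t_deg B.
have [_ SD] := S_alg_submodule B n d.
apply/eqP; rewrite -subr_eq0; apply/eqP.
apply: (S_alg_nondeg t_sym t_deg D1 D2 k_char0) => [|x Tx].
  by rewrite addrC -scaleN1r; apply: SD.
by rewrite mulrBl tens_formB uv // subrr.
Qed.

Lemma T_alg_symmetric : is_symmetric T.
Proof.
pose s u : k := xget 0 [set a : k | a *+ d`! = form u].
have sE u : T u -> s u *+ d`! = form u.
  move=> Tu; have [a ea] := T_alg_form_dvd t_sym t_deg k_char0 Tu.
  have ex_a : exists a : k, [set a | a *+ d`! = form u] a by exists a.
  exact: (xgetPex 0 ex_a).
have [[T0 TD] T1 TM _] := T_alg_is_subalgebra B n d k_char0.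
exists s; split=> [c u v Tu Tv|u v Tu Tv|f fL].
- apply: mulfactI; rewrite sE; last exact: TD.
  by rewrite tens_formD tens_formZ mulrnDl -mulrnAr (sE u) // (sE v).
- apply: mulfactI; rewrite sE; last exact: TM.
  by rewrite sE; [exact: tens_form_mulC|apply: TM].
have [z Tz zE] := unimodular fL; exists z; split.
  by split=> // v Tv; apply: mulfactI; rewrite sE ?zE //; apply: TM.
move=> z' [Tz' z'E]; apply: S_eq => [||v Tv]; [exact: TS|exact: TS|].
by rewrite zE // -z'E // sE //; apply: TM.
Qed.

Hypothesis le_dn : (d <= n)%N.

Let omega : {ffun 'I_d -> 'I_n} := [ffun i => widen_ord le_dn i].

Let omega_inj : injective omega.
Proof. by move=> i j; rewrite !ffunE => /(congr1 val) /= /val_inj. Qed.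

Local Notation Q r := (@row_sum k A B n d omega r).
Local Notation U r s := (@tens_unit k A B n d r s).

Let TQ r : T (Q r). Proof. exact: T_alg_transfer. Qed.

(** Over the fraction field, a symmetrizing form [theta] of [C] is the form of
    [T] twisted by a central unit [z], so [C] is contained in [T] as soon as
    [z] is a unit of [T]. Since [C] is self-dual for [theta], it contains an
    element [y] with [z * y = e], the idempotent [row_sum omega]; the units
    [tens_unit omega r] then spread [y] to an inverse of [z] in the whole
    tensor algebra, which lies in [T] by integrality. *)
Lemma symmetric_overalgebra_sub_T (C : set E) : is_subalgebra C -> T `<=` C ->
  C `<=` S -> is_symmetric C -> C `<=` T.
Proof.
move=> [C_mod _ CM _] TC CS [theta [thL thC th_dual]].
have T_sub := T_alg_is_subalgebra B n d k_char0.
have thZ := linear_onZ C_mod thL.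
have T_mul_fact u : S u -> T (u *+ d`!).
  by move=> Su; rewrite -transfer_S //; apply: T_alg_transfer.
have [z Tz zT] : exists2 z, T z &
    forall v, T v -> form (z * v) = theta v *+ d`!.
  by apply: unimodular => c u v /TC Cu /TC Cv; apply: thL.
(* The identity extends from T to C because d! C is contained in T. *)
have zE v : C v -> form (z * v) = theta v *+ d`!.
  move=> Cv; apply: mulfactI.
  have := zT _ (T_mul_fact _ (CS _ Cv)).
  by rewrite -scaler_nat -kalg_scaleAr tens_formZ thZ // !mulr_natl.
have zC u : C u -> z * u = u * z.
  move=> Cu; apply: S_eq => [||v /TC Cv].
  - by apply: S_algM; [apply: TS|apply: CS].
  - by apply: S_algM; [apply: CS|apply: TS].
  rewrite -mulrA zE; last exact: CM.
  rewrite thC // -zE; last exact: CM.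
  by rewrite mulrA (tens_form_mulC t_sym t_deg) mulrA.
have [|y [[Cy yE] _]] := th_dual (fun v => form (U omega omega * v)).
  by move=> c u v _ _; rewrite mulrDr -kalg_scaleAr tens_formD tens_formZ.
have zy : z * y = Q omega.
  apply: S_eq => [||v /TC Cv]; [|exact/TS/TQ|].
    by apply: S_algM; [apply: TS|apply: CS].
  rewrite -mulrA zE; last exact: CM.
  by rewrite yE // -(tens_form_transfer t_sym) //; apply: CS.
pose y' := \sum_r Q r * y * U omega r.
have zy' : z * y' = 1.
  rewrite /y' mulr_sumr -(sum_tens_unit B n d); apply: eq_bigr => r _.
  rewrite !mulrA zC; last by apply: TC; apply: TQ.
  by rewrite -(mulrA (Q r)) zy -mulrA !row_sum_unit.
have Ty' : T y'.
  apply: (@subalgebra_inv k E _ (fun i => tens_vec (enum_val i)) _ T z) => //.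
  move=> u; exists (fun i => tens_coord u (enum_val i)).
  by rewrite -[LHS]tens_coordK; apply: big_enum_val.
move=> u Cu; have Cy'u : C (y' * u) by apply: CM => //; apply: TC.
(* The form takes values in d! k on u T, so self-duality of T applies to u. *)
have [u' Tu' u'E] : exists2 u', T u' &
    forall v, T v -> form (u' * v) = theta (y' * u * v) *+ d`!.
  apply: unimodular => c v v' /TC Cv /TC Cv'.
  by rewrite mulrDr -kalg_scaleAr thL //; apply: CM.
suff -> : u = u' by [].
apply: S_eq => [||v Tv]; [exact: CS|exact: TS|].
have Cy'uv : C (y' * u * v) by apply: CM => //; apply: TC.
by rewrite u'E // -zE // !mulrA zy' mul1r.
Qed.

Lemma T_alg_maximally_symmetric : maximally_symmetric S T.
Proof.
split.
- exact: S_alg_is_subalgebra.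
- split; [exact: T_alg_is_subalgebra|exact: T_alg_sub_S|].
  exists #|@Tri_rep k A B n d|.
  by split; [apply: T_alg_has_rank|apply: S_alg_has_rank].
- exact: T_alg_symmetric.
move=> C C_sub [TC nCT] CS C_sym; apply: nCT.
exact: symmetric_overalgebra_sub_T.
Qed.

End Maximality.

Lemma fraction_pchar0 (k : idomainType) : [pchar {fraction k}] =i pred0 ->
  forall m : nat, (0 < m)%N -> m%:R != 0 :> k.
Proof.
move=> /pcharf0P ch0 m m0; rewrite -tofrac_eq0 rmorph_nat ch0.
by rewrite -lt0n.
Qed.

Theorem theorem3p10 (k : idomainType) (k_pid : is_pid k)
    (k_char0 : [pchar {fraction k}] =i pred0)
    (A : graded_algebra k) (t : A -> k)
    (t_sym : symmetrizing_form [set: A] t) (t_deg : degree_m2 t)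
    (B : homog_basis A) (n d : nat) (n_gt0 : (0 < n)%N) (le_dn : (d <= n)%N) :
  maximally_symmetric (S_alg B n d) (T_alg B n d).
Proof.
have char0 := fraction_pchar0 k_char0.
exact: (T_alg_maximally_symmetric t_sym t_deg B char0 le_dn).
Qed.
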